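(* Let $k$ be a field of characteristic $2$, let $\Delta$ be a simplicial homology sphere of dimension $n-1$ over $k$ with vertices $v_1,\ldots,v_N$, and let $H(\Delta)$ be its generic cohomology ring over the field of rational functions $K=k(a_{i,j})_{1\le i\le n,\,1\le j\le N}$. Let $l=x_1+x_2+\cdots+x_N\in H^1(\Delta)$. Then for every integer $m$ with $0\le m\leq n/2$ the quadratic form \[ Q_l: H^m(\Delta)\to H^n(\Delta)\simeq K,\qquad Q_l(g)=l^{\,n-2m}g^2, \] is anisotropic; that is, if $g\in H^m(\Delta)$ and $l^{\,n-2m}g^2=0$ in $H^n(\Delta)$, then $g=0$.
   Context: A pure (finite, abstract) simplicial complex $\Delta$ of dimension $n-1$ is a homology sphere over a coefficient ring $R$ if for every simplex $\tau\in\Delta$, including the empty simplex (of dimension $-1$), the reduced simplicial homology of the link satisfies $\tilde H_i(\operatorname{Link}\tau;R)=R$ if $i=n-2-\dim\tau$ and $0$ otherwise. For a simplicial complex $\Delta$ of dimension $n-1$ with vertices $v_1,\ldots,v_N$ and a field $k$, let $K=k(a_{i,j})$ be the field of rational functions in indeterminates $a_{i,j}$, $1\le i\le n$, $1\le j\le N$. The Stanley-Reisner ring is $\mathcal A(\Delta)=K[x_1,\ldots,x_N]/I_\Delta$, where $I_\Delta$ is generated by the square-free monomials $\prod_{i\in S}x_i$ such that $\{v_i\}_{i\in S}$ is not a simplex of $\Delta$. The (generic) cohomology ring is the graded ring $H(\Delta)=\mathcal A(\Delta)/(\theta_1,\ldots,\theta_n)$, where $\theta_i=a_{i,1}x_1+\cdots+a_{i,N}x_N$.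 Its degree $m$ part is $H^m(\Delta)$. For a homology sphere over $k$ one has $H^n(\Delta)\simeq K$ (one-dimensional), and anisotropy does not depend on the choice of this isomorphism. *)

(* Defs.v *)
From HB Require Import structures.
From mathcomp Require Import all_boot all_order all_algebra.
From mathcomp Require Import boolp.
From mathcomp Require Import mpoly.

Set Implicit Arguments.
Unset Strict Implicit.
Unset Printing Implicit Defensive.

Import GRing.Theory.
Local Open Scope ring_scope.
Local Open Scope quotient_scope.

(* The vertex v_j is the element j of 'I_N, and every v_j is a vertex. *)
Record scomplex (N : nat) := SComplex {
  faces :> {set {set 'I_N}};
  face0 : set0 \in faces;
  face_sub : forall s t : {set 'I_N}, s \in faces -> t \subset s -> t \in faces;
  face_vertex : forall v : 'I_N, [set v] \in faces
}.

(* Pure of dimension n - 1: every face lies in a face with n vertices, and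
   all faces have at most n vertices. *)
Definition pure_dim (N n : nat) (D : scomplex N) : Prop :=
  (forall s, s \in (D : {set _}) -> (#|s| <= n)%N) /\
  (forall s, s \in (D : {set _}) ->
     exists t, [/\ t \in (D : {set _}), s \subset t & #|t| = n]).

Definition link (N : nat) (L : {set {set 'I_N}}) (t : {set 'I_N}) :
    {set {set 'I_N}} :=
  [set s : {set 'I_N} | [disjoint s & t] && (s :|: t \in L)].

(* Reduced simplicial homology.  Everything is indexed by the number d of
   vertices of the simplices, so that d stands for homological degree d - 1;
   d = 0 is the augmentation degree, spanned by the empty simplex. *)
Section ReducedHomology.
Variables (k : fieldType) (N : nat).

Definition chain := {ffun {set 'I_N} -> k^o}.

Definition simplex_chain (s : {set 'I_N}) : chain :=
  [ffun t => (t == s)%:R].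

(* [v_0, ..., v_p] |-> \sum_i (-1)^i [v_0, ..., ^v_i, ..., v_p], with the
   vertices listed in increasing order. *)
Definition bd (c : chain) : chain :=
  \sum_(s : {set 'I_N}) \sum_(v in s)
     ((-1) ^+ #|[set w in s | (w < v)%N]| * c s) *: simplex_chain (s :\ v).

Fact bd_linear : linear bd.
Proof.
move=> a u v; rewrite /bd scaler_sumr -big_split; apply: eq_bigr => s _ /=.
rewrite scaler_sumr -big_split; apply: eq_bigr => w _ /=.
by rewrite !ffunE scalerA -scalerDl mulrDr mulrCA.
Qed.
HB.instance Definition _ := GRing.isLinear.Build k chain chain _ bd bd_linear.

Fact bd_simplex (s : {set 'I_N}) : bd (simplex_chain s) =
  \sum_(v in s) (-1) ^+ #|[set w in s | (w < v)%N]| *: simplex_chain (s :\ v).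
Proof.
rewrite /bd (bigD1 s) //= [X in _ + X]big1 => [|t /negPf ts].
  by rewrite addr0; apply: eq_bigr => v _; rewrite ffunE eqxx mulr1.
by apply: big1 => v _; rewrite ffunE ts mulr0 scale0r.
Qed.

Fact card_lt (s : {set 'I_N}) (v w : 'I_N) : v \in s ->
  #|[set u in s | (u < w)%N]| = ((v < w) + #|[set u in s :\ v | (u < w)%N]|)%N.
Proof.
move=> vs; rewrite (cardsD1 v) inE vs; congr (_ + _)%N.
by apply: eq_card => u; rewrite !inE andbA.
Qed.

Fact bd_bd_simplex (s : {set 'I_N}) : bd (bd (simplex_chain s)) = 0.
Proof.
pose G (v w : 'I_N) : chain := ((-1) ^+ #|[set u in s | (u < v)%N]| *
    (-1) ^+ #|[set u in s :\ v | (u < w)%N]|) *: simplex_chain (s :\ v :\ w).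
have -> : bd (bd (simplex_chain s)) =
    \sum_(p : 'I_N * 'I_N | [&& p.1 \in s, p.2 \in s & p.2 != p.1]) G p.1 p.2.
  rewrite bd_simplex linear_sum -(pair_big_dep (mem s)
    (fun v w => (w \in s) && (w != v)) G) /=; apply: eq_bigr => v vs.
  rewrite linearZ /= bd_simplex scaler_sumr; apply: eq_big => [w|w _].
    by rewrite !inE andbC.
  by rewrite scalerA.
rewrite (bigID (fun p : 'I_N * 'I_N => (p.1 < p.2)%N)) /=.
rewrite [X in _ + X](reindex_inj (inv_inj (@swap_pairK _ _))) /=.
rewrite [X in _ + X](eq_bigl (fun p : 'I_N * 'I_N =>
    [&& p.1 \in s, p.2 \in s & p.2 != p.1] && (p.1 < p.2)%N)); last first.
  case=> v w /=; rewrite -leqNgt (eq_sym v) andbCA leq_eqVlt.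
  case: (eqVneq w v) => [->|ne]; rewrite ?andbF //.
  by case: eqP => [/ord_inj e|//]; rewrite e eqxx in ne.
rewrite -big_split big1 //= => -[v w] /= /andP[/and3P[vs ws ne] vw].
rewrite /G (card_lt w vs) (card_lt v ws) vw ltnNge (ltnW vw) /=.
rewrite add1n add0n exprS.
have -> : s :\ w :\ v = s :\ v :\ w by rewrite !setDDl setUC.
by rewrite -scalerDl mulN1r mulNr mulrC subrr scale0r.
Qed.

Variable L : {set {set 'I_N}}.

Definition chains (d : nat) : {vspace chain} :=
  (\sum_(s in L | #|s| == d) <[simplex_chain s]>)%VS.

Definition cycles (d : nat) : {vspace chain} :=
  (chains d :&: lker (linfun bd))%VS.

Definition boundaries (d : nat) : {vspace chain} :=
  (linfun bd @: chains d.+1)%VS.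

Fact boundaries_sub_cycles d :
  (forall s t : {set 'I_N}, s \in L -> t \subset s -> t \in L) ->
  (boundaries d <= cycles d)%VS.
Proof.
move=> sub; rewrite /boundaries limg_sum.
apply/subv_sumP => s /andP[sL /eqP cs].
rewrite limg_line -memvE lfunE /= memv_cap memv_ker lfunE /= bd_bd_simplex.
rewrite eqxx andbT bd_simplex; apply: memv_suml => v vs; apply: memvZ.
apply/subvP: (memv_line (simplex_chain (s :\ v))).
apply: sumv_sup (subvv _); rewrite (sub s) ?subsetDl //=.
by apply/eqP; move: cs; rewrite (cardsD1 v) vs add1n => -[].
Qed.

Definition bounding (d : nat) : {pred subvs_of (cycles d)} :=
  fun z => vsval z \in boundaries d.
Arguments bounding : clear implicits.

Fact bounding_submod d : submod_closed (bounding d).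
Proof.
split=> [|a u v]; first exact: mem0v.
by move=> Bu Bv; rewrite /in_mem /= /bounding linearP memvD ?memvZ.
Qed.
HB.instance Definition _ d :=
  GRing.isSubmodClosed.Build k (subvs_of (cycles d)) (bounding d)
    (bounding_submod d).

Definition homology (d : nat) : Type := Quotient.quot (bounding d).

HB.instance Definition _ d := GRing.Zmodule.on (homology d).

Definition homology_scale d (a : k) (x : homology d) : homology d :=
  \pi_(Quotient.quot (bounding d)) (a *: repr x).

Fact homology_scale_pi d a (z : subvs_of (cycles d)) :
  homology_scale a (\pi_(Quotient.quot (bounding d)) z : homology d) =
  \pi_(Quotient.quot (bounding d)) (a *: z).
Proof.
apply/eqP; rewrite -Quotient.idealrBE -scalerBr rpredZ //.
by rewrite Quotient.idealrBE reprK.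
Qed.

Fact homology_scaleA d a b (x : homology d) :
  homology_scale a (homology_scale b x) = homology_scale (a * b) x.
Proof.
rewrite -[x](@reprK _ (Quotient.quot (bounding d))).
by rewrite !homology_scale_pi scalerA.
Qed.

Fact homology_scale1 d : left_id 1 (@homology_scale d).
Proof.
move=> x; rewrite -[x](@reprK _ (Quotient.quot (bounding d))).
by rewrite homology_scale_pi scale1r.
Qed.

Fact homology_scaleDr d : right_distributive (@homology_scale d) +%R.
Proof.
move=> a x y; rewrite -[x](@reprK _ (Quotient.quot (bounding d))).
rewrite -[y](@reprK _ (Quotient.quot (bounding d))) -[_ + _ in LHS]raddfD.
by rewrite !homology_scale_pi scalerDr raddfD.
Qed.

Fact homology_scaleDl d (x : homology d) :
  {morph (@homology_scale d)^~ x : a b / a + b}.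
Proof.
move=> a b; rewrite -[x](@reprK _ (Quotient.quot (bounding d))).
by rewrite !homology_scale_pi scalerDl raddfD.
Qed.

HB.instance Definition _ d :=
  GRing.Zmodule_isLmodule.Build k (homology d) (@homology_scaleA d)
    (@homology_scale1 d) (@homology_scaleDr d) (@homology_scaleDl d).

End ReducedHomology.

(* With d = i + 1, the degree i = n - 2 - dim t is the one with d + #|t| = n,
   since dim t = #|t| - 1. *)
Definition homology_sphere (k : fieldType) (N n : nat) (D : scomplex N) : Prop :=
  pure_dim n D /\
  forall t, t \in (D : {set _}) -> forall d : nat,
    if (d + #|t| == n)%N
    then exists f : {linear homology k (link D t) d -> k^o}, bijective f
    else forall x : homology k (link D t) d, x = 0.

Section IdealGeneratedBy.
Variables (R : comNzRingType) (T : finType) (P : pred T) (F : T -> R).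

Definition ideal_gen : {pred R} :=
  fun x => `[< exists c : T -> R, x = \sum_(t | P t) c t * F t >].

Fact ideal_genP x :
  reflect (exists c : T -> R, x = \sum_(t | P t) c t * F t) (x \in ideal_gen).
Proof. exact: asboolP. Qed.

Fact ideal_gen_closed : 1 \notin ideal_gen -> idealr_closed ideal_gen.
Proof.
move=> one; split=> //.
  by apply/ideal_genP; exists (fun=> 0); rewrite big1 // => t _; rewrite mul0r.
move=> a x y /ideal_genP[c ->] /ideal_genP[e ->]; apply/ideal_genP.
exists (fun t => a * c t + e t); rewrite mulr_sumr -big_split.
by apply: eq_bigr => t _; rewrite mulrDl mulrA.
Qed.

End IdealGeneratedBy.

Section GenericCohomology.
Variables (k : fieldType) (n N : nat).

Definition coef_field : fieldType := {fraction {mpoly k[n * N]}}.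
Local Notation K := coef_field.

Definition coef (i : 'I_n) (j : 'I_N) : K :=
  tofrac ('X_(mxvec_index i j) : {mpoly k[n * N]}).

Variable D : scomplex N.

Definition SR_ideal : {pred {mpoly K[N]}} :=
  ideal_gen (fun s : {set 'I_N} => s \notin (D : {set _}))
            (fun s => \prod_(j in s) 'X_j).

Fact SR_ideal_coef0 p : p \in SR_ideal -> p@_0%MM = 0.
Proof.
case/ideal_genP=> c ->; rewrite raddf_sum big1 // => s sD /=.
case: (set_0Vmem s) => [s0|[j js]]; first by rewrite s0 face0 in sD.
by rewrite (bigD1 j) //= !rmorphM /= mcoeffX mnm1_eq0 mul0r mulr0.
Qed.

Fact SR_ideal_closed : idealr_closed SR_ideal.
Proof.
apply: ideal_gen_closed; apply/negP => /SR_ideal_coef0/eqP.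
by rewrite mcoeff1 eqxx oner_eq0.
Qed.
HB.instance Definition _ := isIdealr.Build {mpoly K[N]} SR_ideal SR_ideal_closed.

Definition SR_ring : comNzRingType := {ideal_quot SR_ideal}.

Definition SR_pi (p : {mpoly K[N]}) : SR_ring := \pi_({ideal_quot SR_ideal}) p.

Definition theta (i : 'I_n) : SR_ring :=
  SR_pi (\sum_(j < N) coef i j *: 'X_j).

Definition theta_ideal : {pred SR_ring} := ideal_gen predT theta.

Fact theta_ideal_closed : idealr_closed theta_ideal.
Proof.
apply: ideal_gen_closed; apply/negP => /ideal_genP[c] eq1.
have: 1 - \sum_i repr (c i) * (\sum_(j < N) coef i j *: 'X_j) \in SR_ideal.
  rewrite Quotient.idealrBE; apply/eqP; rewrite rmorph1 rmorph_sum [LHS]eq1.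
  by apply: eq_bigr => i _; rewrite rmorphM; congr (_ * _); rewrite [RHS]reprK.
move/SR_ideal_coef0/eqP; rewrite raddfB raddf_sum /= mcoeff1 eqxx big1 => [|i _].
  by rewrite subr0 oner_eq0.
rewrite rmorphM /= raddf_sum big1 ?mulr0 // => j _.
by rewrite /= mcoeffZ mcoeffX mnm1_eq0 mulr0.
Qed.
HB.instance Definition _ := isIdealr.Build SR_ring theta_ideal theta_ideal_closed.

Definition cohomology : comNzRingType := {ideal_quot theta_ideal}.

Definition cohomology_pi (p : {mpoly K[N]}) : cohomology :=
  \pi_({ideal_quot theta_ideal}) (SR_pi p).

(* g lies in the graded piece H^m(D), the image of the forms of degree m. *)
Definition in_degree (m : nat) (g : cohomology) : Prop :=
  exists2 p : {mpoly K[N]}, p \is m.-homog & g = cohomology_pi p.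

Definition ell : cohomology := cohomology_pi (\sum_(j < N) 'X_j).

End GenericCohomology.

(* Main.v *)
Require Import Defs.
From HB Require Import structures.
From mathcomp Require Import all_boot all_order all_algebra.
From mathcomp Require Import boolp ring zify.
From mathcomp Require Import mpoly.

Set Implicit Arguments.
Unset Strict Implicit.
Unset Printing Implicit Defensive.

Import GRing.Theory.
Local Open Scope ring_scope.
Local Open Scope quotient_scope.

(** Let [l] be the sum of the variables.  The proof rests on a linear functional
    [Psi] on the forms of degree [n], the degree map, which kills the monomials
    of nonfaces and the multiples of the [theta_i], and which has two
    properties.

    - Duality ([Psi_nondegenerate]): a form [q] of degree [d] with
      [Psi (q y) = 0] for all monomials [y] of degree [n - d] is zero in the
      cohomology ring.
    - The differential rule ([derI_Psi]): let [d_I] be the composite of the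
      derivatives with respect to the indeterminates [a_(i, I i)], one for
      each row [i], and let [x_I] be the product of the variables [x_(I i)].
      Then [d_I (Psi (x^J))] is the square of [Psi] at the square root of
      [x_I x^J], or zero if [x_I x^J] is not a square.

    Squares are constants for derivations in characteristic 2, so the rule
    extends: [d_I (Psi (q^2 x^z))] is the square of [Psi (q y)] when
    [y^2 = x_I x^z].  Now let [l^s g^2 = 0] with [s <= n - 2m].  Then
    [Psi (g^2 l^s x^z) = 0] for all [z].  Write [l^s] as the square of
    [l^(s/2)], times [l] if [s] is odd.  Applying [d_I] with suitable [I] and
    [z] gives [Psi (g l^(s/2) y) = 0] for every monomial [y] ([halve_power]), so
    [g l^(s/2) = 0] by duality.  Hence [g^2 l^(s/2) = 0], and one descends to
    [g = 0].

    The functional is a sum over the facets of explicit rational functions of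
    minors of the matrix [a].  Two facts about a single simplex are used in
    turn, each time with one row less.  The degree map of the boundary of a
    simplex is the sum of the contributions [Phi] of its facets, which is
    Lagrange interpolation ([lagrange]); and the first row enters [Phi] only
    through one minor in the denominator, whose derivative gives the degree map
    of the boundary of a smaller simplex ([derI_Phi]).  These two facts prove the
    differential rule.  With the fact that every wall lies in an even number of
    facets they also show that [Psi] kills the [theta_i] ([Psi_theta]).

    Duality uses the homology of the links.  In each multidegree the complex
    that joins the Stanley-Reisner ring, the polynomial rings of the facets,
    those of the faces with one vertex less, and so on, is the chain complex of
    a link, so it is exact.  On the ring of one face the Koszul complex of the
    [theta_i] is exact in positive degrees ([koszul_at_exact]).  A zigzag in the
    double complex turns a form [G] of degree [m] into a family of constants in
    the exterior power [m], indexed by the faces with [n - m] vertices, which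
    vanishes only if [G] is zero in the cohomology ring ([reach_zeroc]).  If it
    does not vanish at the face [t], the zigzag of [x_t G] ends at a nonzero
    element of the top exterior power, which is a line, so that
    [Psi (x_t G)] is nonzero ([dual_faces]).

    There are no signs in characteristic 2: a minor depends only on the set of
    its columns, an element of the exterior algebra is a function on subsets,
    and boundaries are plain sums. *)

(** * Characteristic two *)

Section Char2.
Variables (K : fieldType) (char2 : 2%N \in [pchar K]).

Lemma addrr2 (x : K) : x + x = 0.
Proof. exact: addrr_pchar2. Qed.

Lemma oppr2 (x : K) : - x = x.
Proof. exact: oppr_pchar2. Qed.

Lemma eq_of_addr0 (x y : K) : x + y = 0 -> x = y.
Proof. by move/eqP; rewrite addr_eq0 oppr2 => /eqP. Qed.

(** A symmetric sum off the diagonal counts each unordered pair twice; this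
    is where characteristic 2 replaces every sign argument below. *)
Lemma sum_sym_offdiag (T : finType) (A : {set T}) (F : T -> T -> K) :
    (forall u v, F u v = F v u) ->
  \sum_(u in A) \sum_(v in A :\ u) F u v = 0.
Proof.
move=> symF; have [m] := ubnP #|A|; elim: m A => // m IH A ltA.
have [->|[w wA]] := set_0Vmem A; first by rewrite big_set0.
rewrite (big_setD1 w) //=.
rewrite [X in _ + X](eq_bigr (fun u => F u w + \sum_(v in A :\ w :\ u) F u v)).
  rewrite big_split /= addrA IH; last first.
    by rewrite (cardsD1 w A) wA in ltA.
  by rewrite addr0 [X in _ + X](eq_bigr (F w)) ?addrr2.
move=> u /setD1P[uw uA]; rewrite (big_setD1 w) ?inE 1?eq_sym ?uw //=.
by congr (_ + _); apply: eq_bigl => v; rewrite !inE andbCA.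
Qed.

End Char2.

Lemma sqr_sum_pchar2 (R : comNzRingType) (char2 : 2%N \in [pchar R]) (T : Type) (s : seq T) (P : pred T) (F : T -> R) :
  (\sum_(x <- s | P x) F x) ^+ 2 = \sum_(x <- s | P x) F x ^+ 2.
Proof.
apply: (big_morph (fun x : R => x ^+ 2)); last by rewrite expr0n.
by move=> x y; rewrite sqrrD -mulr_natr (pcharf0 char2) mulr0 addr0.
Qed.

(** * Lagrange interpolation *)

Section DividedDifference.
Variables (K : fieldType) (T : finType).

(** The left side is the top coefficient of the Lagrange polynomial that
    interpolates [p] at the nodes, and by the size bound this is [p] itself. *)
Lemma divided_difference (A : {set T}) (t : T -> K) (p : {poly K}) :
    {in A &, injective t} -> A != set0 -> (size p <= #|A|)%N ->
  \sum_(v in A) p.[t v] / \prod_(u in A :\ v) (t v - t u) = p`_(#|A|.-1).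
Proof.
move=> injt /set0Pn[w wA] szp.
pose L v := \prod_(u in A :\ v) ('X - (t u)%:P).
have sL v : v \in A -> size (L v) = #|A|.
  by move=> vA; rewrite /L -big_enum /= size_prod_XsubC -cardE (cardsD1 v A) vA.
have Lv v u : v \in A -> u \in A -> u != v -> (L v).[t u] = 0.
  move=> vA uA uv; rewrite horner_prod (big_setD1 u) ?inE ?uv //=.
  by rewrite hornerXsubC subrr mul0r.
have LvE v : (L v).[t v] = \prod_(u in A :\ v) (t v - t u).
  by rewrite horner_prod; apply: eq_bigr => u _; rewrite hornerXsubC.
have nz v : v \in A -> \prod_(u in A :\ v) (t v - t u) != 0.
  move=> vA; apply/prodf_neq0 => u /setD1P[uv uA]; rewrite subr_eq0.
  by apply: contra_neq uv => /injt-> .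
pose q := \sum_(v in A) (p.[t v] / \prod_(u in A :\ v) (t v - t u)) *: L v.
have qE v : v \in A -> q.[t v] = p.[t v].
  move=> vA; rewrite horner_sum (bigD1 v) //= [X in _ + X]big1 => [|u /andP[uA uv]].
    by rewrite hornerZ LvE divfK ?nz // addr0.
  by rewrite hornerZ Lv ?mulr0 // eq_sym.
have pq : p = q.
  apply/eqP; rewrite -subr_eq0; apply/eqP.
  apply: (@roots_geq_poly_eq0 _ _ [seq t v | v <- enum A]).
  - apply/allP=> x /mapP[v]; rewrite mem_enum => vA ->.
    by rewrite rootE hornerD hornerN qE // subrr.
  - rewrite map_inj_in_uniq ?enum_uniq //.
    by move=> u v; rewrite !mem_enum; exact: injt.
  - rewrite size_map -cardE (leq_trans (size_polyD _ _)) // geq_max szp size_polyN.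
    apply: (leq_trans (size_sum _ _ _)); apply/bigmax_leqP => v vA.
    by rewrite (leq_trans (size_scale_leq _ _)) ?sL.
rewrite [in RHS]pq coef_sum; apply: eq_bigr => v vA; rewrite coefZ.
have -> : (L v)`_(#|A|.-1) = 1.
  rewrite -(sL v vA) -[X in X = _]/(lead_coef (L v)).
  by apply/monicP/monic_prod => u _; exact: monicXsubC.
by rewrite mulr1.
Qed.

End DividedDifference.

(** * Minors of the coefficient matrix *)

Section Minors.
Variables (K : fieldType) (char2 : 2%N \in [pchar K]) (n N : nat).
Variable a : 'I_n -> 'I_N -> K.
Implicit Types (t : {set 'I_N}) (l : seq 'I_n).

(** The determinant of the rows [l] and the columns [t], in the form of its
    Laplace expansion along the first row.  In characteristic 2 the order of
    the columns is irrelevant, so a set of columns suffices. *)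
Fixpoint minor (l : seq 'I_n) (t : {set 'I_N}) : K :=
  if l is i :: l' then \sum_(v in t) a i v * minor l' (t :\ v)
  else (t == set0)%:R.

Lemma minor_size l t : #|t| != size l -> minor l t = 0.
Proof.
elim: l t => [|i l IH] t /=; first by rewrite cards_eq0 => /negPf->.
move=> st; apply: big1 => v vt; rewrite IH ?mulr0 //.
by move: st; rewrite (cardsD1 v t) vt.
Qed.

(** The left side is the expansion of a determinant with the row [i]
    repeated. *)
Lemma minor_row l t i :
  i \in l -> \sum_(v in t) a i v * minor l (t :\ v) = 0.
Proof.
elim: l t => // j l IH t; rewrite inE; case: (eqVneq i j) => [<- _|_ /= il].
  rewrite /= -[RHS](sum_sym_offdiag char2 t (F := fun u v => a i u * a i v * minor l (t :\ u :\ v))).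
    by apply: eq_bigr => v vt; rewrite mulr_sumr; apply: eq_bigr => u _; rewrite mulrA.
  by move=> u v; rewrite !setDDl setUC [a i u * _]mulrC.
transitivity (\sum_(u in t) a j u * (\sum_(v in t :\ u) a i v * minor l (t :\ u :\ v))).
  under eq_bigr => v _ do rewrite /= mulr_sumr.
  under [RHS]eq_bigr => v _ do rewrite /= mulr_sumr.
  rewrite (exchange_big_dep (mem t)) /=; last by move=> v u vt /setD1P[].
  apply: eq_bigr => u ut; apply: eq_big => [v|v /andP[_ uv]].
    by rewrite !inE ut andbT eq_sym andbC.
  by rewrite mulrCA !setDDl setUC.
by apply: big1 => u _; rewrite IH ?mulr0.
Qed.

Variable der : 'I_n -> 'I_N -> K -> K.
Hypothesis derD : forall i v, {morph der i v : x y / x + y}.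
Hypothesis derM : forall i v x y, der i v (x * y) = der i v x * y + x * der i v y.
Hypothesis der_coef : forall i v i' v',
  der i v (a i' v') = ((i == i') && (v == v'))%:R.

Lemma der0 i v : der i v 0 = 0.
Proof. by apply/eqP; rewrite -(inj_eq (addrI (der i v 0))) -derD !addr0. Qed.

Lemma der1 i v : der i v 1 = 0.
Proof.
apply/eqP; rewrite -(inj_eq (addrI (der i v 1))) addr0.
by have := derM i v 1 1; rewrite !mulr1 mul1r => <-.
Qed.

Lemma der_sum i v (I : Type) (r : seq I) (P : pred I) (F : I -> K) :
  der i v (\sum_(x <- r | P x) F x) = \sum_(x <- r | P x) der i v (F x).
Proof. by apply: big_morph; [exact: derD | exact: der0]. Qed.

Lemma der_minor l t i v : i \notin l -> der i v (minor l t) = 0.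
Proof.
elim: l t => [|j l IH] t /=; first by case: eqP; rewrite (der0, der1).
rewrite inE negb_or => /andP[/negPf ij il]; rewrite der_sum big1 // => u _.
by rewrite derM der_coef ij mul0r IH // mulr0 addr0.
Qed.

Lemma der_minor_head l t i v : i \notin l ->
  der i v (minor (i :: l) t) = if v \in t then minor l (t :\ v) else 0.
Proof.
move=> il; rewrite /= der_sum.
under eq_bigr => u _ do rewrite derM der_coef eqxx der_minor // mulr0 addr0.
case: ifP => vt.
  rewrite (bigD1 v) //= eqxx mul1r big1 ?addr0 // => u /andP[_ uv].
  by rewrite eq_sym (negPf uv) mul0r.
by apply: big1 => u ut; case: eqP ut => [<-|]; rewrite (vt, mul0r).
Qed.

(** A minor is linear in each entry of its first row, and its derivative with
    respect to such an entry is a smaller minor; so a vanishing minor would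
    force a smaller one to vanish. *)
Lemma minor_neq0 l t : uniq l -> #|t| = size l -> minor l t != 0.
Proof.
elim: l t => [|i l IH] t; first by move=> _ /eqP; rewrite cards_eq0 => /= ->; exact: oner_neq0.
move=> /andP[il ul] st; have [t0|[v vt]] := set_0Vmem t.
  by rewrite t0 cards0 in st.
have: minor l (t :\ v) != 0.
  by apply: IH => //; move: st; rewrite (cardsD1 v) vt => -[].
by apply: contra_neq => t0; rewrite -[LHS]/(if true then minor l (t :\ v) else 0) -vt -(der_minor_head t v il) t0 der0.
Qed.

(** A vector proportional to the cofactors is killed by one more row only if
    the factor is zero, since pairing the cofactors with that row gives a
    minor, which is not zero. *)
Lemma prop_minor_eq0 i l t (z : 'I_N -> K) : uniq (i :: l) ->
    #|t| = (size l).+1 ->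
    {in t &, forall u v, z u * minor l (t :\ v) = z v * minor l (t :\ u)} ->
    \sum_(v in t) a i v * z v = 0 ->
  {in t, forall v, z v = 0}.
Proof.
move=> ul st propz kz w wt; have /andP[_ ul'] := ul.
have nz v : v \in t -> minor l (t :\ v) != 0.
  by move=> vt; apply: minor_neq0 => //; move: st; rewrite (cardsD1 v) vt => -[].
have zE v : v \in t -> z v = z w / minor l (t :\ w) * minor l (t :\ v).
  by move=> vt; rewrite mulrAC -(propz v w) // mulfK ?nz.
move: kz; under eq_bigr => v vt do rewrite (zE v vt) mulrCA.
rewrite -mulr_sumr => /eqP; rewrite mulf_eq0.
rewrite -[X in _ || (X == 0)]/(minor (i :: l) t) (negPf (minor_neq0 ul st)) orbF.
by rewrite mulf_eq0 invr_eq0 (negPf (nz w wt)) orbF => /eqP.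
Qed.

(** The cofactors span the kernel of a matrix with one more column than rows.
    Combining [y] with the cofactors so as to kill the entry at [v] leaves a
    kernel vector of a square matrix, to which the induction applies through
    its last rows. *)
Lemma ker_minor l t (y : 'I_N -> K) : uniq l -> #|t| = (size l).+1 ->
    (forall i, i \in l -> \sum_(v in t) a i v * y v = 0) ->
  {in t &, forall u v, y u * minor l (t :\ v) = y v * minor l (t :\ u)}.
Proof.
elim: l t y => [|i l IH] t y ul st ky u v ut vt.
  by move/eqP: st => /cards1P[w tw]; move: ut vt; rewrite tw !inE => /eqP-> /eqP->.
have /andP[_ ul'] := ul.
case: (eqVneq u v) => [->//|uv].
pose z w := y w * minor (i :: l) (t :\ v) + y v * minor (i :: l) (t :\ w).
have kz j : j \in i :: l -> \sum_(w in t :\ v) a j w * z w = 0.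
  move=> jl; have zv : z v = 0 by rewrite /z addrr2.
  have -> : \sum_(w in t :\ v) a j w * z w = \sum_(w in t) a j w * z w.
    by rewrite [RHS](big_setD1 v) //= zv mulr0 add0r.
  rewrite /z; under eq_bigr => w _ do rewrite mulrDr mulrA (mulrCA (a j w)).
  by rewrite big_split -mulr_suml ky // mul0r -mulr_sumr minor_row // mulr0; exact: addr0.
have sv : #|t :\ v| = (size l).+1 by move: st; rewrite (cardsD1 v) vt => -[].
have z0 : {in t :\ v, forall w, z w = 0}.
  apply: (prop_minor_eq0 ul sv); last by rewrite kz ?mem_head.
  by apply: IH => // j jl; rewrite kz // inE jl orbT.
by apply: (eq_of_addr0 char2); apply: z0; rewrite !inE uv.
Qed.

Lemma ker_minor0 l t (y : 'I_N -> K) : uniq l -> #|t| = size l ->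
    (forall i, i \in l -> \sum_(v in t) a i v * y v = 0) ->
  {in t, forall v, y v = 0}.
Proof.
case: l => [|i l]; first by move=> _ /eqP; rewrite cards_eq0 => /eqP-> _ v; rewrite inE.
move=> ul st ky; apply: (prop_minor_eq0 ul st); last by rewrite ky ?mem_head.
by apply: ker_minor => // [|j jl]; [case/andP: ul | rewrite ky // inE jl orbT].
Qed.

End Minors.

(** * Local degree functions *)

Section LinearForms.
Variables (K : fieldType) (N : nat).

Definition mon (x : 'I_N -> K) (H : 'X_{1..N}) : K := \prod_v x v ^+ H v.

Lemma monD x H1 H2 : mon x (H1 + H2)%MM = mon x H1 * mon x H2.
Proof. by rewrite -big_split; apply: eq_bigr => v _; rewrite mnmDE exprD. Qed.

Lemma mon0 x : mon x 0%MM = 1.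
Proof. by apply: big1 => v _; rewrite mnmE. Qed.

Lemma monU x v : mon x U_(v)%MM = x v.
Proof.
rewrite /mon (bigD1 v) //= mnm1E eqxx expr1 big1 ?mulr1 // => u /negPf uv.
by rewrite mnm1E eq_sym uv.
Qed.

Lemma monZ c x H : mon (fun v => c * x v) H = c ^+ mdeg H * mon x H.
Proof.
rewrite mdegE -prodrXr -big_split; apply: eq_bigr => v _ /=.
by rewrite exprMn.
Qed.

Lemma mon_eq x y H : x =1 y -> mon x H = mon y H.
Proof. by move=> xy; apply: eq_bigr => v _; rewrite xy. Qed.

(** A degree bound together with the coefficient at that bound, which unlike
    the leading coefficient is multiplicative even when it vanishes. *)
Definition has_top (d : nat) (c : K) (p : {poly K}) :=
  (size p <= d.+1)%N /\ p`_d = c.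

Lemma has_topM d d' c c' p p' :
  has_top d c p -> has_top d' c' p' -> has_top (d + d') (c * c') (p * p').
Proof.
move=> [sp <-] [sp' <-]; split.
  apply: (leq_trans (size_polyMleq _ _)).
  by rewrite -subn1 leq_subLR (leq_trans (leq_add sp sp')) // addSn addnS.
have dlt : (d < (d + d').+1)%N by rewrite ltnS leq_addr.
rewrite coefM (bigD1 (Ordinal dlt)) //= addKn big1 ?addr0 // => i ne.
have: (i : nat) != d by apply: contra_neq ne => id; apply: val_inj.
case: ltngtP => // id _; last by rewrite nth_default ?mul0r // (leq_trans sp).
rewrite [X in _ * X]nth_default ?mulr0 // (leq_trans sp') // ltn_subRL.
by rewrite ltn_add2r.
Qed.

(** A monomial restricted to the line through [x] with direction [y]. *)
Lemma mon_poly (x y : 'I_N -> K) (H : 'X_{1..N}) :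
  exists2 p : {poly K}, has_top (mdeg H) (mon y H) p &
    forall s, p.[s] = mon (fun v => x v + s * y v) H.
Proof.
exists (\prod_v ((x v)%:P + y v *: 'X) ^+ H v); last first.
  by move=> s; rewrite horner_prod; apply: eq_bigr => v _; rewrite !hornerE mulrC.
have top1 : has_top 0 1 (1 : {poly K}) by split; rewrite ?size_poly1 ?coef1.
rewrite mdegE /mon; apply: (big_ind3 has_top) => // [d c p d' c' p' h|v _].
  exact: has_topM.
elim: (H v) => [|h IH]; first by rewrite !expr0.
rewrite !exprS -add1n; apply: has_topM => //; split; last first.
  by rewrite coefD coefC coefZ coefX mulr1 add0r.
rewrite (leq_trans (size_polyD _ _)) // geq_max (leq_trans (size_polyC_leq1 _)) //.
by rewrite (leq_trans (size_scale_leq _ _)) // size_polyX.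
Qed.

End LinearForms.

Section Local.
Variables (K : fieldType) (char2 : 2%N \in [pchar K]) (n N : nat).
Variable a : 'I_n -> 'I_N -> K.
Implicit Types (t r : {set 'I_N}) (l : seq 'I_n) (H M : 'X_{1..N}).
Local Notation minor := (minor a).

Definition cof l t v := minor l (t :\ v).

(** For [#|t| = (size l).+1] the rows [l] have, on the columns [t], a kernel
    spanned by the cofactors [cof l t].  When [H] has degree [size l], this is
    the value of the degree map on the boundary of the simplex [t] for the
    parameters given by the rows [l]. *)
Definition Xi l t H := mon (cof l t) H / \prod_(v in t) cof l t v.

(** The contribution of the facet [r] to the degree map for the parameters
    given by the rows [l]: the monomial divided by the product of the
    variables and by the minor, at the point of [K^r] where all parameters
    vanish except the first, up to a homogeneous rescaling. *)
Definition Phi l r H :=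
  mon (cof (behead l) r) H / (minor l r * \prod_(u in r) cof (behead l) r u).

Lemma PhiE i l r H : Phi (i :: l) r H = Xi l r H / minor (i :: l) r.
Proof. by rewrite /Phi /Xi /= invfM mulrA mulrAC. Qed.

Variable der : 'I_n -> 'I_N -> K -> K.
Hypothesis derD : forall i v, {morph der i v : x y / x + y}.
Hypothesis derM : forall i v x y, der i v (x * y) = der i v x * y + x * der i v y.
Hypothesis der_coef : forall i v i' v',
  der i v (a i' v') = ((i == i') && (v == v'))%:R.

Local Notation minor_neq0 := (minor_neq0 derD derM der_coef).

Lemma cof_neq0 l t v : uniq l -> #|t| = (size l).+1 -> v \in t -> cof l t v != 0.
Proof.
move=> ul st vt; apply: minor_neq0 => //.
by move: st; rewrite (cardsD1 v t) vt => -[].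
Qed.

Lemma cof_out l t v : #|t| = (size l).+1 -> v \notin t -> cof l t v = 0.
Proof.
move=> st vt; apply: minor_size; have -> : t :\ v = t.
  by apply/setP=> u; rewrite !inE; case: eqP => [->|//]; rewrite (negPf vt).
by rewrite st eqn_leq ltnn.
Qed.

(** The boundary of the simplex [t] is the sum of its facets, so their
    contributions add up to [Xi].  The vectors on which the first row is 1 and the
    others are 0 form a line directed by the cofactors; the facet opposite to
    [v] gives the point of the line where the coordinate [v] vanishes, and the
    identity is that of divided differences at these points. *)
Lemma lagrange l t H : uniq l -> #|t| = (size l).+1 -> mdeg H = size l ->
  Xi l t H = \sum_(v in t) Phi l (t :\ v) H.
Proof.
case: l => [|i l] ul st dH.
  have -> : H = 0%MM by apply/eqP; rewrite -mdeg_eq0 dH.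
  move/eqP: st => /cards1P[w ->]; rewrite /Xi /Phi !big_set1 /= /cof /=.
  by rewrite !mon0 setDv eqxx big_set0 mulr1.
have /andP[il ul'] := ul; rewrite /= in st dH.
pose C := cof (i :: l) t; pose Y u v := minor l (t :\ v :\ u).
have Ysym u v : Y u v = Y v u by rewrite /Y !setDDl setUC.
have stv v : v \in t -> #|t :\ v| = (size l).+1.
  by move=> vt; move: st; rewrite (cardsD1 v t) vt => -[].
have Yout u v : v \in t -> u \notin t :\ v -> Y u v = 0.
  by move=> vt ut; exact: (cof_out (stv v vt) ut).
have Ynz u v : v \in t -> u \in t :\ v -> Y u v != 0.
  by move=> vt; apply: cof_neq0 => //; exact: stv.
have Cnz v : v \in t -> C v != 0 by apply: cof_neq0.
have Cout v : v \notin t -> C v = 0 by exact: cof_out.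
have Yvv v : v \in t -> Y v v = 0 by move=> vt; rewrite Yout // !inE eqxx.
have Yrow j v : v \in t -> j \in i :: l ->
    \sum_(u in t) a j u * Y u v = (j == i)%:R * C v.
  move=> vt; rewrite (big_setD1 v) //= Yvv // mulr0 add0r inE.
  case: eqP => [->|_] /= jl; first by rewrite mul1r.
  by rewrite mul0r minor_row.
(* The three-term Pluecker relation: both sides are kernel vectors of the
   rows, as functions of [u]. *)
have plu u v w : v \in t -> w \in t -> Y u v * C w + Y u w * C v = Y v w * C u.
  move=> vt wt; case: (boolP (u \in t)) => ut; last first.
    have uout x : u \notin t :\ x by rewrite inE (negPf ut) andbF.
    by rewrite (Cout u) // (Yout u v) // (Yout u w) // !(mul0r, mulr0) addr0.
  pose y u := Y u v * C w + Y u w * C v.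
  have ky j : j \in i :: l -> \sum_(u in t) a j u * y u = 0.
    move=> jl; rewrite /y; under eq_bigr => x _ do rewrite mulrDr !mulrA.
    rewrite big_split /= -!mulr_suml !Yrow // -!mulrA [C w * _]mulrC.
    exact: addrr2.
  have := ker_minor char2 derD derM der_coef ul st ky ut vt.
  rewrite /y Yvv // mul0r add0r -/(C v) -/(C u).
  by rewrite mulrAC => /(mulIf (Cnz v vt)).
have XiE : Xi (i :: l) t H = mon C H / \prod_(v in t) C v by [].
have PhiY v : Phi (i :: l) (t :\ v) H =
  mon (Y^~ v) H / (C v * \prod_(u in t :\ v) Y u v) by [].
clearbody C Y.
have [w wt] : exists w, w \in t by apply/set0Pn; rewrite -cards_eq0 st.
(* [z v] is the point of the line for the facet opposite to [v], and [s v] its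
   parameter when [z w] is taken as the origin. *)
pose s v := Y v w / (C v * C w); pose z v u := Y u v / C v.
have zE v u : v \in t -> z v u = z w u + s v * C u.
  move=> vt; rewrite /z /s; apply: (mulIf (Cnz v vt)); apply: (mulIf (Cnz w wt)).
  rewrite divfK ?Cnz // !mulrDl.
  have -> : Y v w / (C v * C w) * C u * C v * C w = Y v w * C u.
    have gen (y c d e : K) : d != 0 -> e != 0 -> y / (d * e) * c * d * e = y * c.
      by move=> d0 e0; field; rewrite d0 e0.
    by rewrite gen ?Cnz.
  have -> : Y u w / C w * C v * C w = Y u w * C v.
    by rewrite mulrAC divfK ?Cnz.
  by rewrite -(plu u v w) // addrCA addrr2 ?addr0.
have zvv v : v \in t -> z v v = 0 by move=> vt; rewrite /z Yvv ?mul0r.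
have zD v u : v \in t -> u \in t -> z v u = (s v - s u) * C u.
  move=> vt ut; rewrite mulrBl -[LHS]subr0 -(zvv u ut) (zE v u) // (zE u u) //.
  by rewrite opprD addrACA subrr add0r.
have sinj : {in t &, injective s}.
  move=> u v ut vt suv; apply/eqP; case: eqVneq => // uv.
  have /eqP := zD v u vt ut; rewrite suv subrr mul0r mulf_eq0 invr_eq0.
  by rewrite (negPf (Cnz v vt)) orbF (negPf (Ynz _ _ vt _)) // !inE uv.
have [p [szp topp] pE] := mon_poly (z w) C H.
have t0 : t != set0 by apply/set0Pn; exists w.
have := @divided_difference _ _ t s p sinj t0; rewrite st /= -dH szp topp.
move=> /(_ isT) dd; rewrite XiE -dd mulr_suml; apply: eq_bigr => v vt.
rewrite pE PhiY.
have -> : mon (Y^~ v) H = C v ^+ (size l).+1 * mon (fun u => z w u + s v * C u) H.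
  by rewrite -dH -monZ; apply: mon_eq => u; rewrite -zE // mulrC divfK ?Cnz.
have -> : \prod_(u in t :\ v) Y u v =
    C v ^+ (size l).+1 * (\prod_(u in t :\ v) (s v - s u) * \prod_(u in t :\ v) C u).
  rewrite -(stv v vt) -prodr_const -!big_split; apply: eq_bigr => u /setD1P[uv ut] /=.
  by rewrite -zD // mulrC divfK ?Cnz.
rewrite [\prod_(v in t) C v](big_setD1 v) //=.
have gen (x b d c k : K) : k != 0 ->
  x / b / (c * d) = k * x / (c * (k * (b * d))).
  move=> k0; rewrite !invfM -[LHS]mul1r -(mulfV k0).
  move: (k^-1) (b^-1) (c^-1) (d^-1) => k' b' c' d'; ring.
by apply: gen; rewrite expf_neq0 ?Cnz.
Qed.


Lemma der_inv i v x : der i v x^-1 = der i v x * x^-1 ^+ 2.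
Proof.
case: (eqVneq x 0) => [->|x0]; first by rewrite invr0 (der0 derD) mul0r.
have := derM i v x x^-1; rewrite mulfV // (der1 derM) => /esym/(eq_of_addr0 char2) E.
by apply: (mulfI x0); rewrite -E expr2 mulrCA mulVKf // mulrC.
Qed.

(** Squares are constants for every derivation in characteristic 2. *)
Lemma der_sq i v x : der i v (x ^+ 2) = 0.
Proof. by rewrite expr2 derM mulrC addrr2. Qed.

Lemma der_sqM i v x y : der i v (x ^+ 2 * y) = x ^+ 2 * der i v y.
Proof. by rewrite derM der_sq mul0r add0r. Qed.

Lemma der_prod0 i v (T : Type) (s : seq T) (P : pred T) (F : T -> K) :
  (forall x, P x -> der i v (F x) = 0) -> der i v (\prod_(x <- s | P x) F x) = 0.
Proof.
move=> F0; elim/big_rec: _ => [|x y Px y0]; first exact: (der1 derM).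
by rewrite derM F0 // y0 mul0r mulr0 addr0.
Qed.

Lemma der_Xi l t H i v : i \notin l -> der i v (Xi l t H) = 0.
Proof.
move=> il; have c0 u : der i v (cof l t u) = 0 by exact: der_minor.
rewrite derM der_inv !der_prod0 ?(mul0r, mulr0) ?addr0 // => u _.
by elim: (H u) => [|h IH]; rewrite ?(der1 derM) // exprS derM IH c0 mul0r mulr0 addr0.
Qed.

Variable I : 'I_n -> 'I_N.

(** One first-order derivative for each row in [l], the row [i] being
    differentiated with respect to its entry in column [I i]. *)
Definition derI l (x : K) : K := foldl (fun y i => der i (I i) y) x l.
Definition expI l : 'X_{1..N} := (\sum_(i <- l) U_(I i))%MM.
Definition evenm H := [forall v : 'I_N, ~~ odd (H v)].
Definition halfm H : 'X_{1..N} := [multinom (H v)./2 | v < N].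

Lemma derI_sqM l x y : derI l (x ^+ 2 * y) = x ^+ 2 * derI l y.
Proof. by elim: l y => //= i l IH y; rewrite der_sqM IH. Qed.

Lemma derI0 l : derI l 0 = 0.
Proof. by elim: l => //= i l IH; rewrite (der0 derD). Qed.

Lemma derI_sum l (T : Type) (s : seq T) (P : pred T) (F : T -> K) :
  derI l (\sum_(x <- s | P x) F x) = \sum_(x <- s | P x) derI l (F x).
Proof.
apply: big_morph; last exact: derI0.
by elim: l => // i l IH x y; rewrite /derI /= derD; exact: IH.
Qed.

Lemma halfmK H : evenm H -> (halfm H + halfm H)%MM = H.
Proof.
move/forallP=> ev; apply/mnmP => v; rewrite mnmDE mnmE addnn.
by rewrite -[RHS]odd_double_half (negPf (ev v)).
Qed.

Lemma evenmD2 H E : evenm (H + (E + E))%MM = evenm H.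
Proof.
by apply: eq_forallb => v; rewrite !mnmDE oddD addnn odd_double addbF.
Qed.

Lemma halfmD2 H E : halfm (H + (E + E))%MM = (halfm H + E)%MM.
Proof.
apply/mnmP => v; rewrite !mnmE /= addnn halfD odd_double andbF add0n.
by rewrite doubleK.
Qed.

Lemma mdeg_expI l : mdeg (expI l) = size l.
Proof. by rewrite mdeg_sum -sum1_size; apply: eq_bigr => i _; rewrite mdeg1. Qed.

Lemma mdeg_halfm H d : evenm H -> mdeg H = (d + d)%N -> mdeg (halfm H) = d.
Proof.
move=> /halfmK {1}<-; rewrite mdegD !addnn => /eqP; rewrite -!muln2 eqn_pmul2r //.
by move/eqP.
Qed.

Lemma Xi_out l t H v : #|t| = (size l).+1 -> v \notin t -> H v != 0%N -> Xi l t H = 0.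
Proof.
move=> st vt Hv; rewrite /Xi /mon (bigD1 v) //= cof_out // expr0n (negPf Hv).
by rewrite !mul0r.
Qed.

Lemma XiD l t H E : Xi l t (H + E)%MM = mon (cof l t) E * Xi l t H.
Proof. by rewrite /Xi monD mulrAC mulrC. Qed.

(** The derivative of the value at [x^H] is the square of the value at the
    square root of [x^H x_I], and zero when there is no such root. *)
Definition frob_rule l (F : 'X_{1..N} -> K) H :=
  derI l (F H) =
    if evenm (H + expI l)%MM then F (halfm (H + expI l)%MM) ^+ 2 else 0.

(** A monomial of degree [#|t| + 1] on [#|t|] variables is divisible by a
    square [x_w^2].  That factor is a constant for the derivatives, and the
    remaining monomial has the degree for which [Xi] is a sum of [Phi]. *)
Lemma derI_Xi l t M :
    (forall r H, #|r| = size l -> mdeg H = size l -> frob_rule l (Phi l r) H) ->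
    uniq l -> #|t| = (size l).+1 -> mdeg M = (size l).+2 ->
  frob_rule l (Xi l t) M.
Proof.
move=> PhiP ul st dM; rewrite /frob_rule.
have [/existsP[v /andP[vt Mv]]|] := boolP [exists v, (v \notin t) && (M v != 0%N)].
  rewrite (Xi_out st vt Mv) derI0; case: ifP => // ev.
  rewrite (Xi_out st vt) ?expr0n //; have := congr1 (fun m : 'X_{1..N} => m v) (halfmK ev).
  rewrite !mnmDE; case: (halfm _ v) => //= /esym/eqP.
  by rewrite addn_eq0 (negPf Mv).
rewrite negb_exists => /forallP Mt.
have [w /andP[wt Mw]] : exists w, (w \in t) && (1 < M w)%N.
  apply/existsP; apply: contraLR (ltnSn (size l).+1) => /existsPn Mle.
  rewrite -leqNgt -[X in (X <= _)%N]dM -st mdegE (bigID (mem t)) /= [X in (_ + X)%N]big1.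
    rewrite addn0 -sum1_card; apply: leq_sum => v vt.
    by have := Mle v; rewrite vt -leqNgt.
  by move=> v vt; have := Mt v; rewrite vt negbK => /eqP.
pose H := (M - (U_(w) + U_(w)))%MM.
have MH : M = (H + (U_(w) + U_(w)))%MM.
  rewrite /H submK //; apply/mnm_lepP => v; rewrite mnmDE mnm1E.
  by case: eqP => // <-.
have dH : mdeg H = size l by move: dM; rewrite MH !mdegD !mdeg1 addn2 => -[].
rewrite MH XiD monD -expr2 derI_sqM lagrange // derI_sum //.
rewrite -addmA [(_ + expI l)%MM]addmC addmA evenmD2 halfmD2.
under eq_bigr => v vt.
  have sv : #|t :\ v| = size l by move: st; rewrite (cardsD1 v t) vt => -[].
  rewrite PhiP //; over.
case: ifP => ev; last by rewrite big1 ?mulr0.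
rewrite XiD exprMn -sqr_sum_pchar2 // -lagrange ?monU //.
by apply: mdeg_halfm => //; rewrite mdegD dH mdeg_expI.
Qed.

(** The first row enters [Phi] only through the minor in the denominator.
    Differentiating its inverse multiplies the monomial by one variable and
    leaves the square of the inverse, which is constant for the other rows;
    there remains [Xi] of the other rows. *)
Lemma derI_Phi l r H :
  uniq l -> #|r| = size l -> mdeg H = size l -> frob_rule l (Phi l r) H.
Proof.
elim: l r H => [|i l IH] r H ul sr dH; rewrite /frob_rule.
  have -> : H = 0%MM by apply/eqP; rewrite -mdeg_eq0 dH.
  move/eqP: sr; rewrite cards_eq0 => /eqP->.
  rewrite /expI big_nil addm0 /Phi /= /cof /= !eqxx !big_set0 !mon0 mulr1 invr1 mulr1.
  have -> : halfm 0%MM = 0%MM by apply/mnmP => v; rewrite !mnmE.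
  by rewrite mon0 mulr1 expr1n ifT //; apply/forallP => v; rewrite mnmE.
have /andP[il ul'] := ul.
rewrite /= PhiE mulrC derM der_Xi // mulr0 addr0 der_inv (der_minor_head derD derM der_coef) //.
have -> : (if I i \in r then minor l (r :\ I i) else 0) = cof l r (I i).
  by case: ifP => // ir; rewrite cof_out // ir.
rewrite mulrAC -[X in X * _ * _](monU) -XiD mulrC derI_sqM.
rewrite (derI_Xi (fun r' H' => IH r' H' ul')) ?mdegD ?mdeg1 ?dH ?addn1 //.
rewrite /expI big_cons addmA PhiE; case: ifP => _; last by rewrite mulr0.
by rewrite [RHS]exprMn mulrC.
Qed.

End Local.

(** * Exterior algebra without signs *)

Section Exterior.
Variables (K : fieldType) (char2 : 2%N \in [pchar K]) (n : nat).
Implicit Types (b lam : 'I_n -> K) (kap : {set 'I_n} -> K) (S : {set 'I_n}).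

(** An element of the exterior algebra of [K^n] is the family of its
    coordinates on the basis indexed by subsets; no signs are needed in
    characteristic 2. *)
Definition contract b kap S := \sum_(i | i \notin S) b i * kap (i |: S).
Definition wedge lam kap S := \sum_(i in S) lam i * kap (S :\ i).

Lemma contract_sum b (T : Type) (s : seq T) (P : pred T) (F : T -> {set 'I_n} -> K) S :
  contract b (fun S => \sum_(x <- s | P x) F x S) S = \sum_(x <- s | P x) contract b (F x) S.
Proof. by rewrite exchange_big; apply: eq_bigr => i _; rewrite mulr_sumr. Qed.

Lemma wedge_sum b (T : Type) (s : seq T) (P : pred T) (F : T -> {set 'I_n} -> K) S :
  wedge b (fun S => \sum_(x <- s | P x) F x S) S = \sum_(x <- s | P x) wedge b (F x) S.
Proof. by rewrite exchange_big; apply: eq_bigr => i _; rewrite mulr_sumr. Qed.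

Lemma contract0 b S : contract b (fun=> 0) S = 0.
Proof. by apply: big1 => i _; rewrite mulr0. Qed.

Lemma wedge0 b S : wedge b (fun=> 0) S = 0.
Proof. by apply: big1 => i _; rewrite mulr0. Qed.

Lemma contractD b k1 k2 S : contract b (fun S => k1 S + k2 S) S = contract b k1 S + contract b k2 S.
Proof. by rewrite -big_split; apply: eq_bigr => i _; rewrite mulrDr. Qed.

Lemma contractZ b e k1 S : contract b (fun S => e * k1 S) S = e * contract b k1 S.
Proof. by rewrite mulr_sumr; apply: eq_bigr => i _; rewrite mulrCA. Qed.

(** The homotopy formula of the Koszul complex. *)
Lemma contract_wedge b lam kap S :
  contract b (wedge lam kap) S + wedge lam (contract b kap) S = (\sum_i lam i * b i) * kap S.
Proof.
rewrite /contract /wedge.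
under eq_bigr => i iS.
  rewrite big_setU1 //= setU1K //.
  rewrite [X in _ + X](eq_bigr (fun l => lam l * kap (i |: S :\ l))); last first.
    move=> l lS; congr (_ * kap _); apply/setP=> x; rewrite !inE.
    by case: (eqVneq x i) => [->|//] /=; rewrite andbT; apply: contraNneq iS => ->.
  rewrite mulrDr mulr_sumr; over.
rewrite big_split /= [X in _ + X](eq_bigr (fun l =>
    lam l * b l * kap S + \sum_(i | i \notin S) b i * (lam l * kap (i |: S :\ l)))); last first.
  move=> l lS; rewrite (bigD1 l) ?inE ?eqxx //= setD1K // mulrDr mulrA; congr (_ + _).
  rewrite mulr_sumr; apply: eq_big => [i|i _]; last by rewrite mulrCA.
  by rewrite !inE negb_and negbK; case: (eqVneq i l) => [->|_]; rewrite ?lS ?andbF ?andbT.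
rewrite big_split /= [X in _ + _ + (_ + X)]exchange_big /=.
rewrite addrACA addrr2 // addr0 mulr_suml [in RHS](bigID (mem S)) /= addrC; congr (_ + _).
by apply: eq_bigr => i _; rewrite mulrA [b i * _]mulrC.
Qed.

Lemma contractC b b' kap S : contract b (contract b' kap) S = contract b' (contract b kap) S.
Proof.
rewrite /contract; under eq_bigr => i _ do rewrite mulr_sumr.
under [RHS]eq_bigr => i _ do rewrite mulr_sumr.
rewrite (exchange_big_dep (fun j => j \notin S)) /=; last first.
  by move=> i j iS; rewrite !inE negb_or => /andP[].
apply: eq_bigr => j jS; apply: eq_big => [i|i _].
  by rewrite !inE !negb_or jS andbT eq_sym andbC.
by rewrite mulrCA setUCA.
Qed.

Lemma contract_contract b kap S : contract b (contract b kap) S = 0.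
Proof.
rewrite /contract -[RHS](sum_sym_offdiag char2 (~: S) (F := fun i j => b i * b j * kap (j |: (i |: S)))).
  apply: eq_big => [i|i _]; first by rewrite inE.
  rewrite mulr_sumr; apply: eq_big => [j|j _].
    by rewrite !inE ?negb_or.
  by rewrite mulrA.
by move=> i j; rewrite setUCA [b i * _]mulrC.
Qed.

End Exterior.

(** * The Koszul complex on a face *)

Section Koszul.
Variables (K : fieldType) (char2 : 2%N \in [pchar K]) (n N : nat).
Variable a : 'I_n -> 'I_N -> K.
Implicit Types (t : {set 'I_N}) (S : {set 'I_n}) (al mu nu : 'X_{1..N}).
Implicit Types (f : 'X_{1..N} -> K) (y z : {set 'I_n} -> 'X_{1..N} -> K).

Definition msup al := [set v | al v != 0%N].

(** Multiplication by [x^mu] in the polynomial ring [K[t]] on the vertices of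
    [t], where the other variables are zero; a polynomial is the function of
    its coefficients. *)
Definition mnm_mul t mu f al :=
  if (msup mu \subset t) && (mu <= al)%MM then f (al - mu)%MM else 0.

(** The Koszul differential of [K[t]] for the linear forms
    [theta_i = \sum_u a i u x_u]. *)
Definition koszul_at t y S al :=
  \sum_u contract (a^~ u) (fun S => mnm_mul t U_(u)%MM (y S) al) S.

Lemma msupD mu nu : msup (mu + nu)%MM = msup mu :|: msup nu.
Proof. by apply/setP => v; rewrite !inE mnmDE addn_eq0 negb_and. Qed.

Lemma msupU v : msup U_(v)%MM = [set v].
Proof. by apply/setP => u; rewrite !inE mnm1E eqb0 negbK eq_sym. Qed.

Lemma lemU v al : (U_(v) <= al)%MM = (v \in msup al).
Proof.
rewrite inE; apply/mnm_lepP/idP => [/(_ v)|h u]; rewrite mnm1E ?eqxx ?lt0n //.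
by case: eqP => // <-; rewrite lt0n.
Qed.

Lemma mnm_mulM t mu nu f : mnm_mul t mu (mnm_mul t nu f) = mnm_mul t (mu + nu)%MM f.
Proof.
apply/funext=> al; rewrite /mnm_mul msupD subUset.
case: (msup mu \subset t) => //=; case: (boolP (mu <= al)%MM) => ma /=; last first.
  rewrite [X in _ && X](_ : _ = false) ?andbF //.
  apply: contraNF ma => /mnm_lepP h; apply/mnm_lepP => v.
  by rewrite (leq_trans _ (h v)) // mnmDE leq_addr.
have -> : (nu <= al - mu)%MM = (mu + nu <= al)%MM.
  move/mnm_lepP: ma => ma; apply/mnm_lepP/mnm_lepP => h v; have := h v;
  by rewrite mnmDE mnmBE leq_subRL // addnC.
by case: ifP => // _; congr f; apply/mnmP => v; rewrite !mnmE subnDA.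
Qed.

Lemma mnm_mul_sum t mu (T : Type) (s : seq T) (P : pred T) (F : T -> 'X_{1..N} -> K) al :
  mnm_mul t mu (fun al => \sum_(x <- s | P x) F x al) al = \sum_(x <- s | P x) mnm_mul t mu (F x) al.
Proof. by rewrite /mnm_mul; case: ifP => // _; rewrite big1. Qed.

Lemma mnm_mul_contract t mu b (F : {set 'I_n} -> 'X_{1..N} -> K) S al :
  mnm_mul t mu (fun al => contract b (F^~ al) S) al = contract b (fun S => mnm_mul t mu (F S) al) S.
Proof. by rewrite /mnm_mul; case: ifP => // _; rewrite contract0. Qed.

Lemma mnm_mul_wedge t mu b (F : {set 'I_n} -> 'X_{1..N} -> K) S al :
  mnm_mul t mu (fun al => wedge b (F^~ al) S) al = wedge b (fun S => mnm_mul t mu (F S) al) S.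
Proof. by rewrite /mnm_mul; case: ifP => // _; rewrite wedge0. Qed.

Lemma mnm_mulD t mu f g al :
  mnm_mul t mu (fun al => f al + g al) al = mnm_mul t mu f al + mnm_mul t mu g al.
Proof. by rewrite /mnm_mul; case: ifP => // _; rewrite addr0. Qed.

Lemma mnm_mulZ t mu (e : K) f al : mnm_mul t mu (fun al => e * f al) al = e * mnm_mul t mu f al.
Proof. by rewrite /mnm_mul; case: ifP => // _; rewrite mulr0. Qed.

Lemma koszul_atD t y z S al :
  koszul_at t (fun S al => y S al + z S al) S al = koszul_at t y S al + koszul_at t z S al.
Proof.
rewrite -big_split; apply: eq_bigr => u _ /=; rewrite -contractD.
by congr (contract _ _ S); apply/funext => S'; rewrite mnm_mulD.
Qed.

Lemma koszul_atZ t (e : K) y S al : koszul_at t (fun S al => e * y S al) S al = e * koszul_at t y S al.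
Proof.
rewrite mulr_sumr; apply: eq_bigr => u _ /=; rewrite -contractZ.
by congr (contract _ _ S); apply/funext => S'; rewrite mnm_mulZ.
Qed.

Lemma mnm_mul_koszul_at t mu y S al :
  mnm_mul t mu (koszul_at t y S) al = koszul_at t (fun S => mnm_mul t mu (y S)) S al.
Proof.
rewrite mnm_mul_sum; apply: eq_bigr => u _; rewrite mnm_mul_contract.
by congr (contract _ _ S); apply/funext => S'; rewrite !mnm_mulM addmC.
Qed.

Lemma koszul_at_sq t y S al : koszul_at t (koszul_at t y) S al = 0.
Proof.
pose F u w := contract (a^~ u) (contract (a^~ w) (fun S => mnm_mul t (U_(u) + U_(w))%MM (y S) al)) S.
transitivity (\sum_u \sum_w F u w).
  apply: eq_bigr => u _; rewrite /F -contract_sum; congr (contract _ _ S); apply/funext => S'.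
  rewrite mnm_mul_sum; apply: eq_bigr => w _; rewrite mnm_mul_contract.
  by congr (contract _ _ S'); apply/funext => S''; rewrite mnm_mulM.
transitivity (\sum_(u in [set: 'I_N]) \sum_(w in [set: 'I_N] :\ u) F u w).
  apply: eq_big => [u|u _]; first by rewrite inE.
  rewrite (bigD1 u) //= {1}/F contract_contract // add0r; apply: eq_bigl => w.
  by rewrite !inE andbT.
by apply: sum_sym_offdiag => // u w; rewrite /F contractC addmC.
Qed.

Lemma sum_neq0 (T : finType) (P : pred T) (F : T -> K) :
  \sum_(x | P x) F x != 0 -> exists2 x, P x & F x != 0.
Proof.
move=> nz; have [/existsP[x /andP[Px Fx]]|] := boolP [exists x, P x && (F x != 0)].
  by exists x.
rewrite negb_exists => /forallP F0; case/eqP: nz; apply: big1 => x Px.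
by apply/eqP; have := F0 x; rewrite Px negbK.
Qed.

Lemma mul_neq0r (x z : K) : x * z != 0 -> z != 0.
Proof. by apply: contra_neq => ->; rewrite mulr0. Qed.

Lemma contract_neq0 b (kap : {set 'I_n} -> K) S :
  contract b kap S != 0 -> exists2 i, i \notin S & kap (i |: S) != 0.
Proof. by case/sum_neq0 => i iS /mul_neq0r; exists i. Qed.

Lemma wedge_neq0 b (kap : {set 'I_n} -> K) S :
  wedge b kap S != 0 -> exists2 i, i \in S & kap (S :\ i) != 0.
Proof. by case/sum_neq0 => i iS /mul_neq0r; exists i. Qed.

Lemma mnm_mul_neq0 t mu f al : mnm_mul t mu f al != 0 ->
  [/\ msup mu \subset t, (mu <= al)%MM & f (al - mu)%MM != 0].
Proof. by rewrite /mnm_mul; case: ifP => [/andP[] //|]; rewrite eqxx. Qed.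

(** Homogeneous elements of [K[t]] with coefficients in an exterior power. *)
Definition formed t p s y := forall S al, y S al != 0 ->
  [/\ msup al \subset t, mdeg al = p & #|S| = s].

Lemma formedD t p s y z : formed t p s y -> formed t p s z ->
  formed t p s (fun S al => y S al + z S al).
Proof.
move=> fy fz S al; case: (eqVneq (y S al) 0) => [->|/fy //].
by rewrite add0r => /fz.
Qed.

Lemma msupB mu al : (mu <= al)%MM -> msup al = msup mu :|: msup (al - mu)%MM.
Proof. by move=> /submK {1}<-; rewrite msupD setUC. Qed.

Lemma mdegB mu al : (mu <= al)%MM -> mdeg al = (mdeg mu + mdeg (al - mu)%MM)%N.
Proof. by move=> /submK {1}<-; rewrite mdegD addnC. Qed.

Lemma koszul_at_formed t p s z : formed t p s.+1 z -> formed t p.+1 s (koszul_at t z).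
Proof.
move=> fz S al /sum_neq0[u _] /contract_neq0[i iS] /mnm_mul_neq0[ut ual] /fz[zt zp zs].
split; first by rewrite (msupB ual) subUset ut.
  by rewrite (mdegB ual) mdeg1 zp.
by move: zs; rewrite cardsU1 iS => -[].
Qed.

(** Each variable of [K[t]] is a combination of the restricted forms
    [theta_i]. *)
Definition dual_family t := forall v, v \in t -> exists lam : 'I_n -> K,
  forall u, u \in t -> \sum_i lam i * a i u = (u == v)%:R.

Lemma koszul_at_wedge t y lam S al :
  koszul_at t (fun S al => wedge lam (y^~ al) S) S al =
  wedge lam (fun S => koszul_at t y S al) S +
    \sum_u (\sum_i lam i * a i u) * mnm_mul t U_(u)%MM (y S) al.
Proof.
rewrite wedge_sum -big_split; apply: eq_bigr => u _ /=.
have E := contract_wedge char2 (a^~ u) lam (fun S => mnm_mul t U_(u)%MM (y S) al) S.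
rewrite -E [RHS]addrCA addrr2 // addr0; congr (contract _ _ S).
by apply/funext => S'; rewrite mnm_mul_wedge.
Qed.

(** Induction on [t]: modulo a variable [x_v] the cycle becomes a boundary,
    and what is left is [x_v y'] for a cycle [y'].  As [x_v] is a combination
    of the [theta_i], multiplication by it is homotopic to zero, so [x_v y'] is
    the boundary of a wedge with [y']. *)
Lemma koszul_at_exact t p s y : dual_family t -> formed t p.+1 s y ->
    (forall S al, koszul_at t y S al = 0) ->
  exists2 z, formed t p s.+1 z & forall S al, y S al = koszul_at t z S al.
Proof.
have [m] := ubnP #|t|; elim: m t y => // m IH t y ltm dual fy Ky.
have [t0|[v vt]] := set_0Vmem t.
  exists (fun _ _ => 0) => [S al|S al]; first by rewrite eqxx.
  have K0 : koszul_at t (fun _ _ => 0) S al = 0.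
    apply: big1 => u _; rewrite -[RHS](contract0 (a^~ u) S).
    by congr (contract _ _ S); apply/funext => S'; rewrite /mnm_mul; case: ifP.
  rewrite K0; apply/eqP; case: eqVneq => // /fy[].
  rewrite t0 subset0 => /eqP al0; rewrite mdegE big1 // => u _.
  by apply/eqP; have := in_set0 u; rewrite -al0 inE => /negbFE.
have vanish S al u : u \notin t -> al u != 0%N -> y S al = 0.
  move=> ut alu; apply/eqP; case: eqVneq => // /fy[/subsetP/(_ u)].
  by rewrite inE alu (negPf ut) => /(_ isT).
(* The restriction to the face opposite to [v]. *)
pose y0 S al := if al v == 0%N then y S al else 0.
have koszul_atD1 (x : {set 'I_n} -> 'X_{1..N} -> K) S al : al v = 0%N ->
    koszul_at (t :\ v) x S al = koszul_at t x S al.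
  move=> alv; apply: eq_bigr => u _; congr (contract _ _ S); apply/funext => S'.
  rewrite /mnm_mul msupU !sub1set in_setD1; case: eqVneq => [->|//] /=.
  by rewrite lemU inE alv eqxx andbF.
have [z0 fz0 yz0] : exists2 z, formed (t :\ v) p s.+1 z &
    forall S al, y0 S al = koszul_at (t :\ v) z S al.
  apply: IH.
  - by move: ltm; rewrite (cardsD1 v t) vt.
  - move=> w /setD1P[_ wt]; have [lam lamP] := dual w wt.
    by exists lam => u /setD1P[_ ut]; exact: lamP.
  - move=> S al; rewrite /y0; case: (eqVneq (al v) 0%N) => [alv|_]; last by rewrite eqxx.
    move=> /fy[alt dal cS]; split=> //; apply/subsetP => u ual; rewrite in_setD1 (subsetP alt) // andbT.
    by apply: contraTneq ual => ->; rewrite inE alv.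
  - move=> S al; case: (eqVneq (al v) 0%N) => [alv|alv].
      rewrite koszul_atD1 // -[RHS](Ky S al); apply: eq_bigr => u _.
      congr (contract _ _ S); apply/funext => S'; rewrite /mnm_mul; case: ifP => // _.
      by rewrite /y0 mnmBE alv sub0n eqxx.
    apply: big1 => u _; rewrite -[RHS](contract0 (a^~ u) S).
    congr (contract _ _ S); apply/funext => S'; rewrite /mnm_mul msupU sub1set in_setD1.
    case: (eqVneq u v) => [//|uv] /=; case: ifP => // _.
    by rewrite /y0 mnmBE mnm1E (negPf uv) subn0 (negPf alv).
pose y1 S al := y S al + koszul_at t z0 S al.
have fz0t : formed t p s.+1 z0.
  move=> S al /fz0[alt -> ->]; split=> //; exact: subset_trans alt (subsetDl _ _).
have fy1 : formed t p.+1 s y1 by apply: formedD => //; exact: koszul_at_formed.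
have y1v S al : al v = 0%N -> y1 S al = 0.
  by move=> alv; rewrite /y1 -koszul_atD1 // -yz0 /y0 alv eqxx addrr2.
have Ky1 S al : koszul_at t y1 S al = 0 by rewrite koszul_atD Ky koszul_at_sq add0r.
(* The quotient by [x_v], as [y1] restricts to zero where [x_v = 0]. *)
pose y' S be := y1 S (be + U_(v))%MM.
have fy' : formed t p s y'.
  move=> S be /fy1[]; rewrite msupD subUset mdegD mdeg1 addn1 => /andP[-> _] [->].
  by [].
have y1E S al : y1 S al = mnm_mul t U_(v)%MM (y' S) al.
  rewrite /mnm_mul msupU sub1set vt lemU inE; case: eqVneq => [/y1v->//|alv] /=.
  by rewrite /y' submK // lemU inE.
have Ky' S be : koszul_at t y' S be = 0.
  have vbe : (U_(v) <= be + U_(v))%MM by exact: lem_addl.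
  have -> : koszul_at t y' S be = mnm_mul t U_(v)%MM (koszul_at t y' S) (be + U_(v))%MM.
    by rewrite /mnm_mul msupU sub1set vt vbe /= addmK.
  rewrite mnm_mul_koszul_at -[RHS](Ky1 S (be + U_(v))%MM); apply: eq_bigr => u _.
  congr (contract _ _ S); apply/funext => S'; congr (mnm_mul _ _ _ _).
  by apply/funext => al; rewrite y1E.
have [lam lamP] := dual v vt.
pose z1 S be := wedge lam (y'^~ be) S.
exists (fun S al => z0 S al + z1 S al) => [|S al].
  apply: formedD => // S be /wedge_neq0[i iS] /fy'[-> -> cS]; split=> //.
  by rewrite (cardsD1 i S) iS cS.
rewrite koszul_atD koszul_at_wedge addrA.
have -> : wedge lam (fun S => koszul_at t y' S al) S = 0.
  by rewrite -[RHS](wedge0 lam S); congr wedge; apply/funext => S'.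
rewrite addr0 (bigD1 v) //= lamP // eqxx mul1r -y1E.
rewrite [X in _ + (_ + X)]big1 => [|u uv].
  by rewrite addr0 /y1 addrCA addrr2 // addr0.
rewrite /mnm_mul msupU sub1set; case: (boolP (u \in t)) => /= [ut|]; last by rewrite mulr0.
by rewrite lamP // (negPf uv) mul0r.
Qed.

End Koszul.

(** * The double complex and Poincare duality *)

Section Zigzag.
Variables (K : fieldType) (char2 : 2%N \in [pchar K]) (n N : nat).
Variable a : 'I_n -> 'I_N -> K.
Variable D : {set {set 'I_N}}.
Implicit Types (t r : {set 'I_N}) (S : {set 'I_n}) (al mu : 'X_{1..N}).

(** [y S t al] is the coefficient of [x^al] in the coordinate [S] of the
    component of [y] at the face [t]; the double complex has the Koszul
    differential in one direction and [face_bd] in the other. *)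
Definition cochain := {set 'I_n} -> {set 'I_N} -> 'X_{1..N} -> K.
Implicit Types (y z c : cochain).

Definition lincomb (e : K) y z : cochain := fun S t al => y S t al + e * z S t al.
(** From a face to its walls, by restriction of polynomials. *)
Definition face_bd y : cochain := fun S r al =>
  if msup al \subset r then \sum_(v | v \notin r) y S (v |: r) al else 0.
Definition koszul y : cochain := fun S t al => koszul_at a t (fun S => y S t) S al.
Definition mul_cochain mu y : cochain := fun S t al => mnm_mul t mu (y S t) al.
Definition zeroc : cochain := fun _ _ _ => 0.

Lemma cochainP y z : (forall S t al, y S t al = z S t al) -> y = z.
Proof. by move=> yz; do 3!apply/funext => ?; exact: yz. Qed.

Lemma face_bd_lin e y z : face_bd (lincomb e y z) = lincomb e (face_bd y) (face_bd z).
Proof.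
apply: cochainP => S r al; rewrite /face_bd /lincomb; case: ifP => _.
  by rewrite big_split -mulr_sumr.
by rewrite mulr0 addr0.
Qed.

Lemma koszul_lin e y z : koszul (lincomb e y z) = lincomb e (koszul y) (koszul z).
Proof. by apply: cochainP => S r al; rewrite /lincomb -koszul_atZ -koszul_atD. Qed.

Lemma face_bd0 : face_bd zeroc = zeroc.
Proof. by apply: cochainP => S r al; rewrite /face_bd big1 ?if_same. Qed.

Lemma lincomb00 e : lincomb e zeroc zeroc = zeroc.
Proof. by apply: cochainP => S r al; rewrite /lincomb mulr0 addr0. Qed.

Lemma lincomb0r e y : lincomb e y zeroc = y.
Proof. by apply: cochainP => S r al; rewrite /lincomb mulr0 addr0. Qed.

Lemma lincombyy y : lincomb 1 y y = zeroc.
Proof. by apply: cochainP => S r al; rewrite /lincomb mul1r addrr2. Qed.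

Lemma koszul0 : koszul zeroc = zeroc.
Proof.
transitivity (lincomb 1 (koszul zeroc) (koszul zeroc)); last exact: lincombyy.
by rewrite -koszul_lin lincomb00.
Qed.

Lemma koszul_sq y : koszul (koszul y) = zeroc.
Proof. by apply: cochainP => S r al; exact: koszul_at_sq. Qed.

Lemma face_bd_sq y : face_bd (face_bd y) = zeroc.
Proof.
apply: cochainP => S r al; rewrite /face_bd; case: ifP => // alr.
rewrite -[RHS](sum_sym_offdiag char2 (~: r) (F := fun v w => y S (w |: (v |: r)) al)); last first.
  by move=> v w; rewrite setUCA.
apply: eq_big => [v|v _]; first by rewrite inE.
rewrite (subset_trans alr) ?subsetUr //; apply: eq_bigl => w.
by rewrite !inE negb_or.
Qed.

Lemma face_bd_mul_cochain mu y : face_bd (mul_cochain mu y) = mul_cochain mu (face_bd y).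
Proof.
apply: cochainP => S r al; rewrite /face_bd /mul_cochain /mnm_mul.
case: (boolP (mu <= al)%MM) => ma; last first.
  by rewrite andbF; case: ifP => // _; rewrite big1 // => v _; rewrite andbF.
rewrite (msupB ma) subUset; case: (boolP (msup mu \subset r)) => //= mr.
case: ifP => // _; apply: eq_bigr => v _.
by rewrite (subset_trans mr) // subsetUr.
Qed.

Lemma koszul_mul_cochain mu y : koszul (mul_cochain mu y) = mul_cochain mu (koszul y).
Proof. by apply: cochainP => S r al; rewrite /mul_cochain mnm_mul_koszul_at. Qed.

Lemma koszul_face_bd y : koszul (face_bd y) = face_bd (koszul y).
Proof.
apply: cochainP => S r al.
transitivity (\sum_u contract (a^~ u) (fun S => face_bd (mul_cochain U_(u)%MM y) S r al) S).
  apply: eq_bigr => u _; congr (contract _ _ S); apply/funext => S'.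
  by rewrite face_bd_mul_cochain.
rewrite /face_bd; case: ifP => alr; last by rewrite big1 // => u _; rewrite contract0.
rewrite [RHS]exchange_big /=; apply: eq_bigr => u _.
by rewrite contract_sum.
Qed.

(** The component of the double complex for faces with [i] vertices and the
    exterior power [j]. *)
Definition located i j y := forall S t al, y S t al != 0 ->
  [/\ t \in D, msup al \subset t, #|t| = i & #|S| = j].
Definition of_degree p y := forall S t al, y S t al != 0 -> mdeg al = p.

Hypothesis Dsub : forall s t, s \in D -> t \subset s -> t \in D.

Lemma located0 i j : located i j zeroc. Proof. by move=> S t al; rewrite eqxx. Qed.

Lemma located_lin i j e y z : located i j y -> located i j z -> located i j (lincomb e y z).
Proof.
move=> fy fz S t al; rewrite /lincomb; case: (eqVneq (y S t al) 0) => [->|/fy //].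
by rewrite add0r => /mul_neq0r/fz.
Qed.

Lemma face_bd_neq0 y S r al : face_bd y S r al != 0 ->
  msup al \subset r /\ exists2 v, v \notin r & y S (v |: r) al != 0.
Proof.
by rewrite /face_bd; case: ifP => [alr /sum_neq0[v vr nz]|]; [split=> //; exists v|rewrite eqxx].
Qed.

Lemma located_face_bd i j y : located i j y -> located i.-1 j (face_bd y).
Proof.
move=> fy S r al /face_bd_neq0[alr [v vr /fy[vrD _ ci cj]]]; split=> //.
  by apply: Dsub vrD _; exact: subsetUr.
by rewrite -ci cardsU1 vr.
Qed.

Lemma of_degree_face_bd p y : of_degree p y -> of_degree p (face_bd y).
Proof. by move=> hy S r al /face_bd_neq0[_ [v _ /hy]]. Qed.

Lemma located_koszul i j z : located i j.+1 z -> located i j (koszul z).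
Proof.
move=> fz S t al /sum_neq0[u _] /contract_neq0[l lS] /mnm_mul_neq0[ut ual] /fz[tD zt zi zj].
split=> //; first by rewrite (msupB ual) subUset ut.
by move: zj; rewrite cardsU1 lS => -[].
Qed.

Lemma located_mul_cochain i j mu y : located i j y -> located i j (mul_cochain mu y).
Proof.
move=> fy S t al /mnm_mul_neq0[mt ma /fy[? ? ? ?]]; split=> //.
by rewrite (msupB ma) subUset mt.
Qed.

(** [k] steps of the zigzag: lift along the Koszul differential, then restrict
    to walls.  On homogeneous elements each step lowers the polynomial degree by one,
    so that [m] steps lead from a form of degree [m] to constants. *)
Fixpoint reach k i j u c : Prop :=
  if k is k'.+1 then exists y, [/\ located i j.+1 y, u = koszul y & reach k' i.-1 j.+1 (face_bd y) c]
  else u = c.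

Lemma reach_lin e k i j u c u' c' :
  reach k i j u c -> reach k i j u' c' -> reach k i j (lincomb e u u') (lincomb e c c').
Proof.
elim: k i j u u' => [|k IH] i j u u' /=; first by move=> -> ->.
move=> [y [fy -> yc]] [y' [fy' -> yc']]; exists (lincomb e y y'); split.
- exact: located_lin.
- by rewrite koszul_lin.
- by rewrite face_bd_lin; exact: IH.
Qed.

Lemma reach_mul_cochain mu k i j u c :
  reach k i j u c -> reach k i j (mul_cochain mu u) (mul_cochain mu c).
Proof.
elim: k i j u => [|k IH] i j u /=; first by move=> ->.
move=> [y [fy -> yc]]; exists (mul_cochain mu y); split.
- exact: located_mul_cochain.
- by rewrite koszul_mul_cochain.
- by rewrite face_bd_mul_cochain; exact: IH.
Qed.

Lemma reach_cat k k' i j u c c' : (k <= i)%N ->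
  reach k i j u c -> reach k' (i - k) (j + k) c c' -> reach (k + k') i j u c'.
Proof.
elim: k i j u => [|k IH] i j u ki /=; first by rewrite subn0 addn0 => ->.
move=> [y [fy -> yc]] cc'; exists y; split=> //.
apply: (IH i.-1 j.+1) => //; first by case: (i) ki.
by rewrite -subn1 -subnDA add1n addSnnS.
Qed.

Hypothesis dualD : forall t, t \in D -> dual_family a t.

Lemma koszul_exact i j p u : located i j u -> of_degree p.+1 u -> koszul u = zeroc ->
  exists y, [/\ located i j.+1 y, of_degree p y & u = koszul y].
Proof.
move=> fu hu Ku.
have ex t : exists z : {set 'I_n} -> 'X_{1..N} -> K,
    (t \in D -> #|t| = i -> formed t p j.+1 z) /\
    (t \in D -> #|t| = i -> forall S al, u S t al = koszul_at a t z S al).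
  have [tD|tD] := boolP (t \in D); last by exists (fun _ _ => 0).
  have [ti|ti] := eqVneq #|t| i; last by exists (fun _ _ => 0); split=> _ ti'; rewrite ti' eqxx in ti.
  have [|S al|z fz uz] := @koszul_at_exact _ char2 _ _ a t p j (fun S => u S t) (dualD tD).
  - by move=> S al nz; have [_ -> _ ->] := fu _ _ _ nz; rewrite (hu _ _ _ nz).
  - by have := congr1 (fun f : cochain => f S t al) Ku.
  - by exists z.
have [f fP] := choice ex.
pose y : cochain := fun S t al => if (t \in D) && (#|t| == i) then f t S al else 0.
exists y; split.
- move=> S t al; rewrite /y; case: ifP => [/andP[tD /eqP ti]|]; last by rewrite eqxx.
  by have [ft _] := fP t; move/(ft tD ti) => [].
- move=> S t al; rewrite /y; case: ifP => [/andP[tD /eqP ti]|]; last by rewrite eqxx.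
  by have [ft _] := fP t; move/(ft tD ti) => [].
- apply: cochainP => S t al; case: (boolP ((t \in D) && (#|t| == i))) => tDi.
    have /andP[tD /eqP ti] := tDi; have [_ /(_ tD ti) ->] := fP t.
    by rewrite /koszul /y tDi.
  rewrite /koszul /y (negPf tDi) -[RHS]/(koszul zeroc S t al) koszul0 /zeroc.
  apply/eqP; case: eqVneq => // /fu[tD _ ti _].
  by rewrite tD ti eqxx in tDi.
Qed.

Lemma reach_exists k i j u : (k <= i)%N ->
    located i j u -> of_degree k u -> face_bd u = zeroc -> koszul u = zeroc ->
  exists c, [/\ located (i - k) (j + k) c, of_degree 0 c, koszul c = zeroc & reach k i j u c].
Proof.
elim: k i j u => [|k IH] i j u ki fu hu bu Ku.
  by exists u; rewrite subn0 addn0.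
have [y [fy hy uy]] := koszul_exact fu hu Ku.
have [|||||c [fc hc Kc rc]] := IH i.-1 j.+1 (face_bd y).
- by rewrite -ltnS (leq_trans ki) // leqSpred.
- exact: located_face_bd.
- exact: of_degree_face_bd.
- exact: face_bd_sq.
- by rewrite koszul_face_bd -uy.
exists c; split=> //; first by rewrite -addSnnS -[k.+1]add1n subnDA subn1.
by exists y.
Qed.

Hypothesis exactD : forall i t (c : {set 'I_N} -> K), t \in D -> (i < n)%N ->
  (forall r, c r != 0 -> [/\ r \in D, t \subset r & #|r| = i]) ->
  (forall r, t \subset r -> \sum_(v | v \notin r) c (v |: r) = 0) ->
  exists2 w : {set 'I_N} -> K,
    (forall r, w r != 0 -> [/\ r \in D, t \subset r & #|r| = i.+1]) &
    (forall r, t \subset r -> c r = \sum_(v | v \notin r) w (v |: r)).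

(** In a fixed multidegree [al] the restriction complex is the chain complex
    of the link of the support of [al], which is exact below the top. *)
Lemma face_bd_exact i j z : (i < n)%N -> located i j z -> face_bd z = zeroc ->
  exists2 y, located i.+1 j y & z = face_bd y.
Proof.
move=> iln fz bz.
have ex (p : {set 'I_n} * 'X_{1..N}) : exists w : {set 'I_N} -> K,
    (forall r, w r != 0 -> [/\ r \in D, msup p.2 \subset r, #|r| = i.+1 & #|p.1| = j]) /\
    (forall r, msup p.2 \subset r -> z p.1 r p.2 = \sum_(v | v \notin r) w (v |: r)).
  case: p => S al /=.
  have [/andP[alD /eqP Sj]|no] := boolP ((msup al \in D) && (#|S| == j)); last first.
    exists (fun=> 0); split=> [r|r _]; first by rewrite eqxx.
    rewrite big1 //; apply/eqP; case: eqVneq => // /fz[rD alr _ Sj].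
    by rewrite Sj (Dsub rD) ?eqxx in no.
  have [r /fz[]|r alr|w wD wz] := @exactD i _ (z S ^~ al) alD iln.
  - by [].
  - by have := congr1 (fun f : cochain => f S r al) bz; rewrite /face_bd alr.
  - by exists w; split=> // r /wD[].
have [w wP] := choice ex.
exists (fun S t al => w (S, al) t).
  by move=> S t al; have [wD _] := wP (S, al); exact: wD.
apply: cochainP => S r al; have [_ wz] := wP (S, al).
rewrite /face_bd; case: ifP => [|alr]; first exact: wz.
by apply/eqP; case: eqVneq => // /fz[_]; rewrite alr.
Qed.

(** If the zigzag ends at zero it can be run backwards: a Koszul lift of each
    stage can be corrected to a lift which restricts to zero on the walls. *)
Lemma reach_zeroc k i j u : (k <= i)%N -> (i <= n)%N -> reach k i j u zeroc ->
  exists z, [/\ located i j.+1 z, face_bd z = zeroc & u = koszul z].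
Proof.
elim: k i j u => [|k IH] i j u ki iln /=.
  by move=> ->; exists zeroc; rewrite face_bd0 koszul0; split=> //; exact: located0.
case: i ki iln => // i ki iln [y [fy -> yc]].
have [z [fz bz yz]] := IH i j.+1 (face_bd y) ki (ltnW iln) yc.
have [z' fz' zz'] := face_bd_exact iln fz bz.
exists (lincomb 1 y (koszul z')); split.
- by apply: located_lin => //; exact: located_koszul.
- by rewrite face_bd_lin -koszul_face_bd -zz' -yz lincombyy.
- by rewrite koszul_lin koszul_sq lincomb0r.
Qed.

Hypothesis Dpure : forall t, t \in D -> exists s, [/\ s \in D, t \subset s & #|s| = n].
Hypothesis wallD : forall r, #|r|.+1 = n -> \sum_(v | v \notin r) ((v |: r) \in D)%:R = 0 :> K.
Hypothesis topD : forall t (c : {set 'I_N} -> K), t \in D ->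
  (forall r, c r != 0 -> [/\ r \in D, t \subset r & #|r| = n]) ->
  (forall r, t \subset r -> \sum_(v | v \notin r) c (v |: r) = 0) ->
  exists e, forall r, r \in D -> t \subset r -> #|r| = n -> c r = e.

Implicit Types G : 'X_{1..N} -> K.

(** The image of the Stanley-Reisner ring in the sum over the facets of their
    polynomial rings. *)
Definition embed G : cochain := fun S t al =>
  if [&& S == set0, t \in D, #|t| == n & msup al \subset t] then G al else 0.

Definition shift mu G al := if (mu <= al)%MM then G (al - mu)%MM else 0.

(** The coefficients of [G] on the monomials supported on faces agree with
    those of a combination of the [theta_i]. *)
Definition in_ideal_coef G := exists h : 'I_n -> 'X_{1..N} -> K, forall al, msup al \in D ->
  G al = \sum_i \sum_(u | al u != 0%N) a i u * h i (al - U_(u))%MM.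

Lemma located_embed G : located n 0 (embed G).
Proof.
move=> S t al; rewrite /embed; case: ifP => [/and4P[/eqP-> tD /eqP-> alt]|]; last by rewrite eqxx.
by rewrite cards0.
Qed.

Lemma of_degree_embed p G : (forall al, G al != 0 -> mdeg al = p) -> of_degree p (embed G).
Proof. by move=> hG S t al; rewrite /embed; case: ifP => _; [exact: hG | rewrite eqxx]. Qed.

Lemma embed_lin e G G' : embed (fun al => G al + e * G' al) = lincomb e (embed G) (embed G').
Proof.
by apply: cochainP => S t al; rewrite /lincomb /embed; case: ifP; rewrite ?mulr0 ?addr0.
Qed.

Lemma mul_cochain_embed mu G : mul_cochain mu (embed G) = embed (shift mu G).
Proof.
apply: cochainP => S t al; rewrite /mul_cochain /mnm_mul /embed /shift.
case: (boolP (mu <= al)%MM) => ma; last by rewrite andbF if_same.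
by rewrite andbT [in RHS](msupB ma) subUset; do !case: (_ \subset _); rewrite ?andbF.
Qed.

(** A wall lies in an even number of facets. *)
Lemma face_bd_embed G : face_bd (embed G) = zeroc.
Proof.
apply: cochainP => S r al; rewrite /face_bd; case: ifP => // alr.
have [rn|rn] := eqVneq #|r|.+1 n; last first.
  by apply: big1 => v vr; rewrite /embed cardsU1 vr add1n (negPf rn) /= !andbF.
have [S0|S0] := eqVneq S set0; last by apply: big1 => v vr; rewrite /embed (negPf S0).
transitivity (G al * \sum_(v | v \notin r) ((v |: r) \in D)%:R); last by rewrite wallD // mulr0.
rewrite mulr_sumr; apply: eq_bigr => v vr.
rewrite /embed S0 cardsU1 vr add1n rn !eqxx (subset_trans alr) ?subsetUr //= andbT.
by case: ifP; rewrite ?mulr1 ?mulr0.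
Qed.

Lemma koszul_embed G : koszul (embed G) = zeroc.
Proof.
apply: cochainP => S t al; apply/eqP; case: eqVneq => //.
move=> /sum_neq0[u _] /contract_neq0[i iS] /mnm_mul_neq0[_ _].
rewrite /embed; case: ifP => [/and4P[/eqP/setP/(_ i)]|]; last by rewrite eqxx.
by rewrite !inE eqxx.
Qed.

(** For each multidegree the family on the facets is a top cycle of a link,
    hence constant, hence it comes from the Stanley-Reisner ring. *)
Lemma embed_in_ideal G z : located n 1 z -> face_bd z = zeroc -> embed G = koszul z -> in_ideal_coef G.
Proof.
move=> fz bz Gz.
have ex (p : 'I_n * 'X_{1..N}) : exists e, forall r,
    r \in D -> msup p.2 \subset r -> #|r| = n -> z [set p.1] r p.2 = e.
  case: p => i al /=; have [alD|alD] := boolP (msup al \in D); last first.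
    by exists 0 => r rD alr; rewrite (Dsub rD alr) in alD.
  apply: (@topD _ (z [set i] ^~ al) alD) => [r /fz[]//|r alr].
  by have := congr1 (fun f : cochain => f [set i] r al) bz; rewrite /face_bd alr.
have [h hP] := choice ex.
exists (fun i al => h (i, al)) => al alD; have [t [tD alt tn]] := Dpure alD.
have -> : G al = embed G set0 t al by rewrite /embed eqxx tD tn eqxx alt.
rewrite Gz exchange_big /= /koszul /koszul_at [LHS](bigID (fun u => al u != 0%N)) /=.
rewrite [X in _ + X]big1 ?addr0 => [|u]; last first.
  rewrite negbK => /eqP alu; rewrite -[RHS](contract0 (a^~ u) set0).
  by congr (contract _ _ _); apply/funext => S'; rewrite /mnm_mul lemU inE alu eqxx andbF.
apply: eq_bigr => u alu; apply: eq_big => [i|i _]; first by rewrite inE.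
have ual : (U_(u) <= al)%MM by rewrite lemU inE.
have := alt; rewrite (msupB ual) msupU subUset => /andP[ut altu].
by rewrite /mnm_mul msupU ut ual /= setU0 -(hP (i, al - U_(u))%MM t).
Qed.

Definition ind t : 'X_{1..N} := [multinom ((v \in t) : nat) | v < N].

Lemma msup_ind t : msup (ind t) = t.
Proof. by apply/setP => v; rewrite inE mnmE eqb0 negbK. Qed.

Lemma indD1 t v : v \in t -> ind t = (ind (t :\ v) + U_(v))%MM.
Proof.
move=> vt; apply/mnmP => w; rewrite mnmDE mnm1E !mnmE in_setD1 eq_sym.
by case: eqVneq => [<-|_]; rewrite ?vt ?addn0.
Qed.

Lemma mdeg_ind t : mdeg (ind t) = #|t|.
Proof.
rewrite mdegE -sum1_card [RHS]big_mkcond; apply: eq_bigr => v _.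
by rewrite mnmE; case: ifP.
Qed.

Definition single t mu (kap : {set 'I_n} -> K) : cochain :=
  fun S t' al => if (t' == t) && (al == mu) then kap S else 0.

(** [kap] is killed by contraction with the columns of [t], so the wedge with
    the form dual to [v] lifts [x_t kap] along the Koszul differential.  The
    lift is divisible by every variable of [t] but [x_v], so it survives only
    on the wall opposite to [v]. *)
Lemma single_step i j t v kap lam : t \in D -> v \in t -> #|t| = i.+1 ->
    (forall S, kap S != 0 -> #|S| = j) ->
    (forall u, u \in t -> forall S, contract (a^~ u) kap S = 0) ->
    (forall u, u \in t -> \sum_i lam i * a i u = (u == v)%:R) ->
  exists y, [/\ located i.+1 j.+1 y, single t (ind t) kap = koszul y &
    face_bd y = single (t :\ v) (ind (t :\ v)) (wedge lam kap)].
Proof.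
move=> tD vt ti kapj kapt lamP.
exists (single t (ind (t :\ v)) (wedge lam kap)); split.
- move=> S t' al; rewrite /single; case: ifP => [/andP[/eqP-> /eqP->]|]; last by rewrite eqxx.
  move=> /wedge_neq0[l lS /kapj cS]; split=> //; first by rewrite msup_ind subsetDl.
  by rewrite (cardsD1 l S) lS cS.
- apply: cochainP => S t' al; rewrite {1}/single /koszul /koszul_at.
  case: (eqVneq t' t) => [->|t't] /=; last first.
    rewrite big1 // => u _; rewrite -[RHS](contract0 (a^~ u) S); congr (contract _ _ S).
    by apply/funext => S'; rewrite /mnm_mul /single (negPf t't) if_same.
  have term u : contract (a^~ u) (fun S0 => mnm_mul t U_(u)%MM (single t (ind (t :\ v)) (wedge lam kap) S0 t) al) S
      = if (u == v) && (al == ind t) then kap S else 0.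
    case: (boolP (u \in t)) => ut; last first.
      have /negPf-> : u != v by apply: contraNneq ut => ->.
      rewrite -[RHS](contract0 (a^~ u) S); congr (contract _ _ S).
      by apply/funext => S'; rewrite /mnm_mul msupU sub1set (negPf ut).
    transitivity ((al == (ind (t :\ v) + U_(u))%MM)%:R * contract (a^~ u) (wedge lam kap) S).
      rewrite -contractZ; congr (contract _ _ S); apply/funext => S'.
      rewrite /mnm_mul msupU sub1set ut /single eqxx /=.
      case: (boolP (U_(u) <= al)%MM) => ual.
        rewrite -[X in _ = (X == _)%:R * _](submK ual) eqm_add2r.
        by case: ifP; rewrite (mul1r, mul0r).
      case: eqP => [alE|]; rewrite ?mul0r //.
      by move: ual; rewrite alE lem_addl.
    have := contract_wedge char2 (a^~ u) lam kap S.
    have -> : wedge lam (contract (a^~ u) kap) S = 0.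
      by rewrite -[RHS](wedge0 lam S); congr wedge; apply/funext => S'; exact: kapt.
    rewrite addr0 => ->; rewrite lamP //; case: (eqVneq u v) => [->|_] /=.
      by rewrite -indD1 // mul1r; case: ifP; rewrite (mul1r, mul0r).
    by rewrite mul0r mulr0.
  under eq_bigr => u _ do rewrite term.
  by rewrite (bigD1 v) //= eqxx big1 ?addr0 // => u /negPf->.
- apply: cochainP => S r al; rewrite /face_bd /single.
  case: (eqVneq al (ind (t :\ v))) => [->|_]; last first.
    by rewrite andbF; case: ifP => // _; rewrite big1 // => w _; rewrite andbF.
  rewrite msup_ind andbT; case: (eqVneq r (t :\ v)) => [->|ne].
    rewrite subxx (bigD1 v) /=; last by rewrite !inE eqxx.
    rewrite setD1K // eqxx big1 ?addr0 // => w /andP[_ wv].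
    rewrite ifF // andbT; apply: contraNF wv => /eqP/setP/(_ v).
    by rewrite !inE eqxx vt orbF eq_sym.
  case: ifP => // tr; rewrite big1 // => w wr; rewrite ifF // andbT.
  apply: contraNF ne => /eqP tE; rewrite eqEsubset tr andbT.
  apply/subsetP => x xr; rewrite in_setD1 -tE !inE xr orbT andbT.
  apply: contraNneq wr => xv; have : w \in t by rewrite -tE !inE eqxx.
  case: (eqVneq w v) => [->|wv wt]; first by rewrite -xv.
  by apply: (subsetP tr); rewrite in_setD1 wv.
Qed.

(** The wedge with the form dual to [v] is nonzero because contraction with
    the column [v] recovers [kap]. *)
Lemma single_reach i j t kap : t \in D -> #|t| = i ->
    (forall S, kap S != 0 -> #|S| = j) ->
    (forall u, u \in t -> forall S, contract (a^~ u) kap S = 0) ->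
    (exists S, kap S != 0) ->
  exists kap' : {set 'I_n} -> K, [/\ forall S, kap' S != 0 -> #|S| = (j + i)%N,
    exists S, kap' S != 0 & reach i i j (single t (ind t) kap) (single set0 0%MM kap')].
Proof.
elim: i j t kap => [|i IH] j t kap tD ti kapj kapt [S0 kapS0].
  exists kap; split=> //; first by move=> S /kapj->; rewrite addn0.
    by exists S0.
  move/eqP: ti; rewrite cards_eq0 => /eqP-> /=; congr single.
  by apply/mnmP => v; rewrite !mnmE inE.
have [v vt] : exists v, v \in t by apply/set0Pn; rewrite -cards_eq0 ti.
have [lam lamP] := dualD tD vt.
have [y [fy Ey by_]] := single_step tD vt ti kapj kapt lamP.
have ctrw u S : u \in t -> contract (a^~ u) (wedge lam kap) S = (u == v)%:R * kap S.
  move=> ut; rewrite -lamP // -contract_wedge //.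
  have -> : wedge lam (contract (a^~ u) kap) S = 0.
    by rewrite -[RHS](wedge0 lam S); congr wedge; apply/funext => S'; exact: kapt.
  by rewrite addr0.
have [|||||kap' [kap'j nz' r']] := IH j.+1 (t :\ v) (wedge lam kap).
- by apply: Dsub tD _; exact: subsetDl.
- by move: ti; rewrite (cardsD1 v t) vt => -[].
- by move=> S /wedge_neq0[l lS /kapj cS]; rewrite (cardsD1 l S) lS cS.
- by move=> u /setD1P[uv ut] S; rewrite ctrw // (negPf uv) mul0r.
- have : contract (a^~ v) (wedge lam kap) S0 != 0 by rewrite ctrw // eqxx mul1r.
  by case/contract_neq0 => l _ nz; exists (l |: S0).
exists kap'; split=> //; first by move=> S /kap'j->; rewrite addSnnS.
by exists y; rewrite by_.
Qed.

Lemma mul_ind_single p t c : located #|t| p c -> of_degree 0 c ->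
  mul_cochain (ind t) c = single t (ind t) (fun S => c S t 0%MM).
Proof.
move=> fc hc; apply: cochainP => S t' al; rewrite /mul_cochain /mnm_mul /single msup_ind.
case: (boolP ((t \subset t') && (ind t <= al)%MM)) => [/andP[tt' tal]|no]; last first.
  case: ifP => // /andP[/eqP t't /eqP al_t]; move: no; rewrite t't al_t subxx lepm_refl //.
case: (eqVneq (c S t' (al - ind t)%MM) 0) => [c0|nz]; last first.
  have [_ _ ct' _] := fc _ _ _ nz; have /eqP := hc _ _ _ nz; rewrite mdeg_eq0 => /eqP al0.
  have tE : t' = t by apply/esym/eqP; rewrite eqEcard tt' ct' leqnn.
  have alE : al = ind t by rewrite -(submK tal) al0 add0m.
  by rewrite al0 tE alE !eqxx.
rewrite c0; case: ifP => // /andP[/eqP t't /eqP al_t].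
rewrite -c0 t't al_t; congr (c S t _); apply/mnmP => v; by rewrite mnmBE subnn mnmE.
Qed.

(** Poincare duality before any choice of an isomorphism of the top degree
    with [K].  The zigzag of [G] ends at constants which are not all zero;
    take [t] where they do not vanish.  Multiplying by [x_t] isolates that
    component, and the zigzag of [x_t G] goes on to a nonzero element of the
    top exterior power.  As this is a line, a combination of [x_t G] with any
    form [F] of degree [n] has a zigzag that ends at zero. *)
Lemma dual_faces m G : (m <= n)%N -> (forall al, G al != 0 -> mdeg al = m) ->
    ~ in_ideal_coef G ->
  exists t, [/\ t \in D, #|t| = (n - m)%N &
    forall F : 'X_{1..N} -> K, (forall al, F al != 0 -> mdeg al = n) ->
      exists e, in_ideal_coef (fun al => F al + e * shift (ind t) G al)].
Proof.
move=> mn hG ntG.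
have [c [fc hc Kc rc]] :=
  reach_exists mn (@located_embed G) (of_degree_embed hG) (face_bd_embed G) (koszul_embed G).
have [[S0 [t [al nz]]]|no] := pselect (exists S t al, c S t al != 0); last first.
  have c0 : c = zeroc.
    apply: cochainP => S t al; apply/eqP; case: eqVneq => // nz.
    by case: no; exists S, t, al.
  rewrite c0 in rc; have [z [fz bz Gz]] := reach_zeroc mn (leqnn n) rc.
  by case: ntG; exact: embed_in_ideal fz bz Gz.
have [tD _ ct _] := fc _ _ _ nz; exists t; split=> // F hF.
have := hc _ _ _ nz => /eqP; rewrite mdeg_eq0 => /eqP al0; rewrite {al}al0 in nz.
pose kap S := c S t 0%MM.
have kapt u : u \in t -> forall S, contract (a^~ u) kap S = 0.
  move=> ut S; have := congr1 (fun f : cochain => f S t U_(u)%MM) Kc.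
  rewrite /koszul /koszul_at (bigD1 u) //= [X in _ + X]big1 => [|w wu].
    rewrite addr0 /zeroc => <-; congr (contract _ _ S); apply/funext => S'.
    rewrite /mnm_mul msupU sub1set ut lepm_refl /= /kap; congr c.
    by apply/mnmP => v; rewrite mnmBE subnn mnmE.
  rewrite -[RHS](contract0 (a^~ w) S); congr (contract _ _ S); apply/funext => S'.
  by rewrite /mnm_mul lemU (msupU u) in_set1 (negPf wu) andbF.
have [|kap' [kap'n [S1 nz1] r1]] :=
  @single_reach (n - m) m t kap tD ct (fun S nzS => let: And4 _ _ _ e := fc _ _ _ nzS in e) kapt.
  by exists S0.
have rG : reach n n 0 (embed (shift (ind t) G)) (single set0 0%MM kap').
  rewrite -mul_cochain_embed -[X in reach X](subnKC mn).
  apply: (reach_cat mn (reach_mul_cochain (ind t) rc)).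
  by rewrite add0n (mul_ind_single (p := m)) ?ct.
have [c0 [fc0 hc0 _ rc0]] :=
  reach_exists (leqnn n) (@located_embed F) (of_degree_embed hF) (face_bd_embed F) (koszul_embed F).
have top S : #|S| = n -> S = setT.
  by move=> cS; apply/eqP; rewrite eqEcard subsetT cardsT card_ord cS leqnn.
have S1T : S1 = setT by apply: top; rewrite (kap'n _ nz1) subnKC.
(* The scalar for which the two zigzags cancel on the top exterior power. *)
exists (c0 setT set0 0%MM / kap' setT).
set e := _ / _; have := reach_lin e rc0 rG; rewrite -embed_lin.
have -> : lincomb e c0 (single set0 0%MM kap') = zeroc.
  apply: cochainP => S t' al'; rewrite /lincomb /zeroc.
  have [/and3P[/eqP-> /eqP-> /eqP->]|ne] :=
      boolP [&& S == setT, t' == set0 & al' == 0%MM].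
    by rewrite /single !eqxx /e divfK -?S1T // addrr2.
  have -> : c0 S t' al' = 0.
    apply/eqP; case: eqVneq => // nz0; have [_ _] := fc0 _ _ _ nz0.
    rewrite subnn add0n => /eqP ct0 /top cS; have /eqP := hc0 _ _ _ nz0.
    rewrite mdeg_eq0 => al0; rewrite cards_eq0 in ct0.
    by rewrite cS eqxx ct0 al0 in ne.
  rewrite add0r /single; case: ifP => [/andP[t0 al0]|]; last by rewrite mulr0.
  have [->|/kap'n] := eqVneq (kap' S) 0; first by rewrite mulr0.
  by rewrite subnKC // => /top cS; rewrite cS t0 al0 eqxx in ne.
move=> /(reach_zeroc (leqnn n) (leqnn n)) [z [fz bz Gz]].
exact: embed_in_ideal fz bz Gz.
Qed.

End Zigzag.

(** * Chains on a homology sphere *)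

Section ExtendScalars.
Variables (k K : fieldType) (iota : {rmorphism k -> K}) (I J L : finType).

(** Exactness at one place of a complex with entries in the prime ring is a
    statement on ranks, so it passes from [k] to any extension [K]. *)
Lemma extend_scalars (M : I -> J -> nat) (P : L -> I -> nat) :
    (forall c : I -> k, (forall j, \sum_i c i * (M i j)%:R = 0) ->
       exists w : L -> k, forall i, c i = \sum_l w l * (P l i)%:R) ->
  forall c : I -> K, (forall j, \sum_i c i * (M i j)%:R = 0) ->
    exists w : L -> K, forall i, c i = \sum_l w l * (P l i)%:R.
Proof.
move=> exk c cM.
pose Mm : 'M[k]_(#|I|, #|J|) := \matrix_(i, j) (M (enum_val i) (enum_val j))%:R.
pose Pm : 'M[k]_(#|L|, #|I|) := \matrix_(l, i) (P (enum_val l) (enum_val i))%:R.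
have sub : (kermx Mm <= Pm)%MS.
  apply/row_subP => r; pose v := row r (kermx Mm).
  have vM : v *m Mm = 0 by rewrite -row_mul mulmx_ker row0.
  have [j|w wP] := exk (fun i => v 0 (enum_rank i)).
    have := congr1 (fun A : 'rV_#|J| => A 0 (enum_rank j)) vM; rewrite !mxE => E.
    rewrite -[RHS]E (reindex enum_rank) /=; last by apply: onW_bij; exact: enum_rank_bij.
    by apply: eq_bigr => i _; rewrite [Mm _ _]mxE !enum_rankK.
  apply/submxP; exists (\row_l w (enum_val l)); apply/rowP => i.
  have := wP (enum_val i); rewrite enum_valK -/v => ->; rewrite [RHS]mxE.
  rewrite [RHS](reindex enum_rank) /=; last by apply: onW_bij; exact: enum_rank_bij.
  by apply: eq_bigr => l _; rewrite !mxE !enum_rankK.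
have := sub; rewrite -(map_submx iota) map_kermx => subK.
pose v : 'rV[K]_#|I| := \row_i c (enum_val i).
have /sub_kermxP vker : v *m map_mx iota Mm = 0.
  apply/rowP => j; rewrite !mxE -[RHS](cM (enum_val j)).
  rewrite (reindex enum_rank) /=; last by apply: onW_bij; exact: enum_rank_bij.
  by apply: eq_bigr => i _; rewrite !mxE !enum_rankK rmorph_nat.
have /submxP[w wP] := submx_trans vker subK.
exists (fun l => w 0 (enum_rank l)) => i.
have := congr1 (fun A : 'rV_#|I| => A 0 (enum_rank i)) wP.
rewrite !mxE enum_rankK => ->.
rewrite (reindex enum_rank) /=; last by apply: onW_bij; exact: enum_rank_bij.
by apply: eq_bigr => l _; rewrite !mxE !enum_rankK rmorph_nat.
Qed.

End ExtendScalars.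

Section Cycles.
Variables (F : fieldType) (N : nat).
Implicit Types (c : {set 'I_N} -> F) (ok : pred {set 'I_N}) (r s t : {set 'I_N}).

Definition carried ok c := forall s, c s != 0 -> ok s.
Definition closed_chain c := forall r, \sum_(v | v \notin r) c (v |: r) = 0.

End Cycles.

Section ExtendCycles.
Variables (k K : fieldType) (iota : {rmorphism k -> K}) (N : nat) (L : finType).

(** The condition on the carrier is turned into further linear equations. *)
Lemma extend_cycles (ok : pred {set 'I_N}) (P : L -> {set 'I_N} -> nat) :
    (forall c : {set 'I_N} -> k, carried ok c -> closed_chain c ->
       exists w : L -> k, forall i, c i = \sum_l w l * (P l i)%:R) ->
  forall c : {set 'I_N} -> K, carried ok c -> closed_chain c ->
    exists w : L -> K, forall i, c i = \sum_l w l * (P l i)%:R.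
Proof.
move=> exk c okc cyc.
pose M (s : {set 'I_N}) (j : bool * {set 'I_N}) : nat :=
  if j.1 then (\sum_(v | v \notin j.2) (v |: j.2 == s))%N else (s == j.2) && ~~ ok s.
have eqT (F : fieldType) (e : {set 'I_N} -> F) r :
    \sum_s e s * (M s (true, r))%:R = \sum_(v | v \notin r) e (v |: r).
  under eq_bigr => s _ do rewrite /M /= natr_sum mulr_sumr.
  rewrite exchange_big; apply: eq_bigr => v _ /=.
  rewrite (bigD1 (v |: r)) //= eqxx mulr1 big1 ?addr0 // => s /negPf ne.
  by rewrite eq_sym ne mulr0.
have eqF (F : fieldType) (e : {set 'I_N} -> F) r :
    \sum_s e s * (M s (false, r))%:R = e r *+ ~~ ok r.
  rewrite (bigD1 r) //= /M /= eqxx /= mulr_natr big1 ?addr0 // => s /negPf ne.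
  by rewrite ne mulr0.
apply: (@extend_scalars k K iota _ _ _ M) => [e eM|[[] r]].
- apply: exk => [s|r]; last by rewrite -eqT eM.
  by apply: contraR => nok; have := eM (false, s); rewrite eqF nok mulr1n => ->.
- by rewrite eqT.
- rewrite eqF; case: (boolP (ok r)) => //= nok; apply/eqP.
  by apply: contraR nok; exact: okc.
Qed.

End ExtendCycles.

Section LinkHomology.
Variables (k : fieldType) (char2 : 2%N \in [pchar k]) (N : nat).
Implicit Types (s t r : {set 'I_N}) (L : {set {set 'I_N}}).

Lemma chainsP L d (c : chain k N) :
  reflect (forall s, c s != 0 -> (s \in L) && (#|s| == d)) (c \in chains k L d).
Proof.
apply: (iffP idP) => [/memv_sumP[e eP ->] s|supp].
  rewrite sum_ffunE => /sum_neq0[s' s'L]; have /vlineP[x ->] := eP s' s'L.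
  by rewrite !ffunE; case: (eqVneq s s') => [->//|_]; rewrite [_ *: _]mulr0 eqxx.
have -> : c = \sum_(s in L | #|s| == d) c s *: simplex_chain k s.
  apply/ffunP => s; rewrite sum_ffunE; have [sLd|nsLd] := boolP ((s \in L) && (#|s| == d)).
    rewrite (bigD1 s) //= !ffunE eqxx [_ *: _]mulr1 big1 ?addr0 // => s' /andP[_ ne].
    by rewrite !ffunE eq_sym (negPf ne) [_ *: _]mulr0.
  rewrite big1 => [|s' s'L]; first by apply/eqP; apply: contraR nsLd; exact: supp.
  rewrite !ffunE; case: eqP => [E|_]; last by rewrite [_ *: _]mulr0.
  by rewrite E s'L in nsLd.
by apply: memv_suml => s sL; apply: memvZ; apply/(sumv_sup s) => //; exact: subvv.
Qed.

Lemma bdE (c : chain k N) r : bd c r = \sum_(v | v \notin r) c (v |: r).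
Proof.
rewrite /bd sum_ffunE.
transitivity (\sum_(s : {set 'I_N}) \sum_(v in s) c s * (r == s :\ v)%:R).
  apply: eq_bigr => s _; rewrite sum_ffunE; apply: eq_bigr => v _.
  by rewrite !ffunE oppr2 // expr1n mul1r.
rewrite (exchange_big_dep predT) //= [RHS]big_mkcond /=; apply: eq_bigr => v _.
case: ifP => vr.
  rewrite (bigD1 (v |: r)) ?setU11 //= setU1K // eqxx mulr1 big1 ?addr0 // => s /andP[vs ne].
  case: eqP => [E|_]; last by rewrite mulr0.
  by rewrite E setD1K ?eqxx in ne.
rewrite big1 // => s vs; case: eqP => [E|_]; last by rewrite mulr0.
by rewrite E !inE eqxx in vr.
Qed.

Lemma cyclesP L d (c : chain k N) :
  (c \in chains k L d) -> (forall r, \sum_(v | v \notin r) c (v |: r) = 0) ->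
  c \in cycles k L d.
Proof.
move=> cL cyc; rewrite memv_cap cL memv_ker lfunE /=; apply/eqP/ffunP => r.
by rewrite bdE cyc ffunE.
Qed.

Definition hclass L d (z : subvs_of (cycles k L d)) : homology k L d :=
  \pi_(Quotient.quot (@bounding k N L d)) z.

Lemma hclass_eq0 L d (z : subvs_of (cycles k L d)) :
  hclass z = 0 <-> vsval z \in boundaries k L d.
Proof.
have -> : (vsval z \in boundaries k L d) = (z \in @bounding k N L d) by [].
rewrite -[z in z \in _]subr0 Quotient.idealrBE.
have -> : \pi_(Quotient.quot (@bounding k N L d)) 0 = 0 by exact: raddf0.
by split=> [zE|/eqP//]; apply/eqP.
Qed.

Lemma hclass_lin L d a b (x y : subvs_of (cycles k L d)) :
  hclass (a *: x + b *: y) = a *: hclass x + b *: hclass y.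
Proof.
by rewrite -![_ *: hclass _]/(homology_scale _ _) !homology_scale_pi -raddfD.
Qed.

Lemma boundariesP L d (c : chain k N) : c \in boundaries k L d ->
  exists2 w, w \in chains k L d.+1 & c = bd w.
Proof. by case/memv_imgP => w wL ->; exists w; rewrite ?lfunE. Qed.

Lemma acyclic_chains L d (c : {set 'I_N} -> k) :
    (forall x : homology k L d, x = 0) ->
    carried (fun s => (s \in L) && (#|s| == d)) c -> closed_chain c ->
  exists2 w : {set 'I_N} -> k, carried (fun s => (s \in L) && (#|s| == d.+1)) w &
    forall r, c r = \sum_(v | v \notin r) w (v |: r).
Proof.
move=> H0 cL cyc; pose f : chain k N := finfun (c : {set 'I_N} -> k^o).
have fL : f \in chains k L d by apply/chainsP => s; rewrite ffunE; exact: cL.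
have fZ : f \in cycles k L d.
  by apply: cyclesP => // r; rewrite -[RHS](cyc r); apply: eq_bigr => v _; rewrite ffunE.
have /hclass_eq0 := H0 (hclass (Subvs fZ)).
case/boundariesP => w /chainsP wL /= fw; exists (fun s => w s); first exact: wL.
by move=> r; rewrite -bdE -fw ffunE.
Qed.

(** There are no boundaries in top degree, so two cycles with proportional
    classes are proportional. *)
Lemma line_chains L d (f : {linear homology k L d -> k^o}) (c1 c2 : {set 'I_N} -> k) :
    injective f -> (forall s, s \in L -> #|s| != d.+1) ->
    carried (fun s => (s \in L) && (#|s| == d)) c1 -> closed_chain c1 ->
    carried (fun s => (s \in L) && (#|s| == d)) c2 -> closed_chain c2 ->
  (exists s, c2 s != 0) -> exists e, forall s, c1 s = e * c2 s.
Proof.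
move=> finj top c1L cyc1 c2L cyc2 [s0 nz].
have mk c : carried (fun s => (s \in L) && (#|s| == d)) c -> closed_chain c ->
    exists z : subvs_of (cycles k L d), forall s, (vsval z : chain k N) s = c s.
  move=> cL cyc; pose g : chain k N := finfun (c : {set 'I_N} -> k^o).
  have gL : g \in chains k L d by apply/chainsP => s; rewrite ffunE; exact: cL.
  have gZ : g \in cycles k L d.
    by apply: cyclesP => // r; rewrite -[RHS](cyc r); apply: eq_bigr => v _; rewrite ffunE.
  by exists (Subvs gZ) => s; rewrite /= ffunE.
have [z1 z1E] := mk c1 c1L cyc1; have [z2 z2E] := mk c2 c2L cyc2.
have face_bd0 (z : subvs_of (cycles k L d)) : hclass z = 0 -> vsval z = 0.
  move/hclass_eq0/boundariesP => [w /chainsP wL ->].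
  suff -> : w = 0 by rewrite linear0.
  apply/ffunP => s; rewrite ffunE; apply/eqP; case: eqVneq => // /wL/andP[sL /eqP sd].
  by have := top s sL; rewrite sd eqxx.
have h2 : f (hclass z2) != 0.
  apply: contraNneq nz => f0; have /face_bd0 z20 : hclass z2 = 0 by apply: finj; rewrite f0 linear0.
  by rewrite -z2E z20 ffunE.
pose e : k := f (hclass z1) / f (hclass z2); exists e => s.
have /face_bd0 : hclass (1 *: z1 + (- e) *: z2) = 0.
  apply: finj; rewrite hclass_lin linear0 linearP linearZ /= scale1r.
  by rewrite [_ *: _]mulNr divfK // subrr.
rewrite linearP linearZ /= scale1r => /(congr1 (fun g : chain k N => g s)).
rewrite !ffunE z1E z2E => /eqP; rewrite [_ *: _]mulNr subr_eq0 => /eqP ->.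
by [].
Qed.

End LinkHomology.

Lemma disjoint_setU1 (T : finType) (v : T) (r t : {set T}) :
  [disjoint v |: r & t] = (v \notin t) && [disjoint r & t].
Proof. by rewrite !disjoints_subset subUset sub1set inE. Qed.

Lemma setDUK (T : finType) (r t : {set T}) : t \subset r -> r :\: t :|: t = r.
Proof. by move=> tr; rewrite setUC setDE setUIr setUCr setIT (setUidPr tr). Qed.

Lemma disjoint_setD (T : finType) (r t : {set T}) : [disjoint r :\: t & t].
Proof. by rewrite disjoint_sym disjoints_subset setCD subsetUr. Qed.

Section SphereChains.
Variables (k : fieldType) (char2 : 2%N \in [pchar k]) (n N : nat).
Variables (D : scomplex N) (hD : homology_sphere k n D).
Implicit Types (r s t : {set 'I_N}).

(** The link of a wall is a set of points with one-dimensional reduced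
    homology in degree 0.  A generator [c] takes the same value on any two
    points, since the sum of two points is a cycle and so a multiple of [c].
    That value is nonzero and its total over all points is zero. *)
Lemma wall_even r : #|r|.+1 = n ->
  (2 %| #|[set v | (v \notin r) && (v |: r \in (D : {set _}))]|)%N.
Proof.
move=> rn; set V := [set v | _].
have [rD|rD] := boolP (r \in (D : {set _})); last first.
  rewrite (_ : V = set0) ?cards0 //; apply/setP => v; rewrite !inE.
  apply: contraNF rD => /andP[_ vrD]; exact: face_sub vrD (subsetUr _ _).
have [[Dle _] /(_ r rD 1%N)] := hD; rewrite add1n rn eqxx => -[f [g fK gK]].
have linkV s : (s \in link D r) && (#|s| == 1%N) = [exists v, (v \in V) && (s == [set v])].
  apply/andP/existsP => [[sL /cards1P[v sv]]|[v /andP[vV /eqP->]]].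
    exists v; rewrite sv eqxx andbT !inE; move: sL; rewrite inE sv disjoints1.
    by case/andP => ->.
  by rewrite cards1 inE disjoints1 eqxx; move: vV; rewrite inE.
have [c [cL cyc [s0 nz]]] : exists c : {set 'I_N} -> k,
  [/\ carried (fun s => (s \in link D r) && (#|s| == 1%N)) c, closed_chain c & exists s, c s != 0].
  pose z : subvs_of (cycles k (link D r) 1) := repr (g 1).
  have zE : hclass z = g 1 by exact: reprK.
  have /andP[] : (vsval z \in chains k (link D r) 1) && (vsval z \in lker (linfun (@bd k N))).
    by rewrite -memv_cap; exact: subvsP.
  move=> /chainsP zL; rewrite memv_ker lfunE /= => /eqP bz.
  exists (vsval z : chain k N); split=> // [s|]; first by rewrite -bdE // bz ffunE.
  have [[s nz]|no] := pselect (exists s, (vsval z : chain k N) s != 0); first by exists s.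
  have /eqP := oner_neq0 k; case; rewrite -[LHS](gK 1) -zE.
  have -> : z = 0.
    apply: val_inj; apply/ffunP => s; rewrite ffunE; apply/eqP.
    by case: eqVneq => // nz; case: no; exists s.
  suff -> : hclass 0 = 0 :> homology k (link D r) 1 by rewrite linear0.
  by apply/hclass_eq0; rewrite linear0 mem0v.
have top s : s \in link D r -> #|s| != 2%N.
  rewrite inE => /andP[dis /Dle]; rewrite cardsU (disjoint_setI0 dis) cards0 subn0 -rn.
  by rewrite -addn1 addnC leq_add2l; case: #|s| => [|[|[]]].
have constV v w : v \in V -> w \in V -> c [set v] = c [set w].
  move=> vV wV; case: (eqVneq v w) => [->//|vw].
  pose c1 s : k := (s == [set v])%:R + (s == [set w])%:R.
  have c1L : carried (fun s => (s \in link D r) && (#|s| == 1%N)) c1.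
    move=> s; rewrite linkV /c1 => nz1; apply/existsP.
    case: (eqVneq s [set v]) nz1 => [->|_]; first by exists v; rewrite vV eqxx.
    case: (eqVneq s [set w]) => [->|_]; first by exists w; rewrite wV eqxx.
    by rewrite addr0 eqxx.
  have single x s : \sum_(u | u \notin s) ((u |: s == [set x])%:R : k) = (s == set0)%:R.
    case: (eqVneq s set0) => [->|s0'].
      rewrite (bigD1 x) ?inE //= setU0 eqxx big1 ?addr0 // => u /andP[_ /negPf ux].
      by rewrite setU0 (inj_eq set1_inj) ux.
    rewrite big1 // => u us; case: eqP => // /setP E.
    have [y ys] : exists y, y \in s by apply/set0Pn.
    have := E y; rewrite !inE ys orbT => /esym/eqP yx.
    by have := E u; rewrite !inE eqxx -yx => /esym/eqP uy; rewrite uy ys in us.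
  have cyc1 : closed_chain c1 by move=> s; rewrite big_split !single /= addrr2.
  have [|e eP] := line_chains char2 (can_inj fK) top c1L cyc1 cL cyc; first by exists s0.
  have e1 x : x \in [set v; w] -> e * c [set x] = 1.
    rewrite -eP /c1 !inE !(inj_eq set1_inj) => /orP[] /eqP->; rewrite eqxx.
      by rewrite (negPf vw) addr0.
    by rewrite eq_sym (negPf vw) add0r.
  have e0 : e != 0.
    by apply: contraTneq (oner_neq0 k) => e0; rewrite -(e1 v) ?inE ?eqxx // e0 mul0r negbK.
  by apply: (mulfI e0); rewrite !e1 ?inE ?eqxx ?orbT.
have [v0 /andP[v0V /eqP s0E]] : exists v, (v \in V) && (s0 == [set v]).
  by apply/existsP; rewrite -linkV; exact: cL.
have := cyc set0; rewrite (bigID (mem V)) /= [X in _ + X]big1 ?addr0 => [|v /andP[_ vV]]; last first.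
  rewrite setU0; apply/eqP; case: eqVneq => // /cL; rewrite linkV => /existsP[w /andP[wV]].
  by rewrite (inj_eq set1_inj) => /eqP vw; rewrite vw wV in vV.
rewrite (eq_big (mem V) (fun=> c [set v0])) => [|v|v /andP[_ vV]]; first last.
- by rewrite setU0; exact: constV.
- by rewrite inE.
rewrite sumr_const -mulr_natr => /eqP; rewrite mulf_eq0 -s0E (negPf nz) /=.
by rewrite (dvdn_pcharf char2).
Qed.

Lemma wall_sum (F : fieldType) (charF : 2%N \in [pchar F]) r : #|r|.+1 = n ->
  \sum_(v | v \notin r) ((v |: r \in (D : {set _}))%:R : F) = 0.
Proof.
move/wall_even; rewrite (dvdn_pcharf charF) => /eqP; rewrite -sum1_card natr_sum => E.
rewrite -[RHS]E [RHS](eq_bigl (fun v => (v \notin r) && (v |: r \in (D : {set _})))) => [|v]; last by rewrite inE.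
by rewrite [RHS]big_mkcondr; apply: eq_bigr => v _; case: ifP.
Qed.

Definition link_face t d s := (s \in link D t) && (#|s| == d).

(** The sum of all facets of a link is a cycle because each wall lies in an
    even number of facets. *)
Lemma fundamental_closed t d : (d + #|t| = n)%N -> closed_chain (fun s => (link_face t d s)%:R : k).
Proof.
move=> dn r; have [dis|dis] := boolP [disjoint r & t]; last first.
  apply: big1 => v _; rewrite /link_face inE disjoint_setU1 (negPf dis) andbF //.
have [cr|cr] := eqVneq #|r|.+1 d; last first.
  by apply: big1 => v vr; rewrite /link_face cardsU1 vr add1n (negPf cr) andbF.
have crt : #|r :|: t|.+1 = n.
  by rewrite cardsU (disjoint_setI0 dis) cards0 subn0 -addSn cr.
rewrite -[RHS](wall_sum char2 crt) [RHS]big_mkcond [LHS]big_mkcond; apply: eq_bigr => v _.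
rewrite in_setU negb_or /link_face inE disjoint_setU1 dis andbT setUA.
case: (boolP (v \in r)) => //= vr; rewrite cardsU1 vr add1n cr eqxx andbT.
by case: (v \in t).
Qed.

Section OverExtension.
Variables (K : fieldType) (iota : {rmorphism k -> K}).

Lemma exact_link t d (c : {set 'I_N} -> K) : t \in (D : {set _}) -> (d + #|t|)%N != n ->
    carried (link_face t d) c -> closed_chain c ->
  exists2 w : {set 'I_N} -> K, carried (link_face t d.+1) w &
    forall r, c r = \sum_(v | v \notin r) w (v |: r).
Proof.
move=> tD dn.
pose P (l s : {set 'I_N}) := (\sum_(v | v \notin s) ((v |: s == l) && link_face t d.+1 l))%N.
have PE (F : fieldType) (w : {set 'I_N} -> F) s :
    \sum_l w l * (P l s)%:R = \sum_(v | v \notin s) (if link_face t d.+1 (v |: s) then w (v |: s) else 0).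
  under eq_bigr => l _ do rewrite /P natr_sum mulr_sumr.
  rewrite exchange_big; apply: eq_bigr => v _ /=.
  rewrite (bigD1 (v |: s)) //= eqxx big1 ?addr0 /= => [|l /negPf ne].
    by case: ifP; rewrite (mulr1, mulr0).
  by rewrite eq_sym ne mulr0.
move=> cL cyc; have [|w wP] := @extend_cycles k K iota N _ (link_face t d) P _ c cL cyc.
  move=> e eL ecyc; have H0 : forall x : homology k (link D t) d, x = 0.
    by have [_ /(_ t tD d)] := hD; rewrite (negPf dn).
  have [w wL wP] := acyclic_chains char2 H0 eL ecyc.
  exists w => s; rewrite PE wP; apply: eq_bigr => v _.
  by case: ifP => // no; apply/eqP; apply: contraFT no; exact: wL.
exists (fun l => if link_face t d.+1 l then w l else 0) => [s|s]; last by rewrite wP PE.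
by rewrite /carried /=; case: ifP => //; rewrite eqxx.
Qed.

Lemma top_link t d (c : {set 'I_N} -> K) : t \in (D : {set _}) -> (d + #|t|)%N = n ->
    carried (link_face t d) c -> closed_chain c ->
  exists e : K, forall r, link_face t d r -> c r = e.
Proof.
move=> tD dn cL cyc.
have [|w wP] := @extend_cycles k K iota N _ (link_face t d) (fun (_ : unit) s => link_face t d s : nat) _ c cL cyc.
  move=> e eL ecyc; have [[Dle pure] /(_ t tD d)] := hD; rewrite dn eqxx => -[f [g fK gK]].
  have top s : s \in link D t -> #|s| != d.+1.
    rewrite inE => /andP[dis /Dle]; rewrite cardsU (disjoint_setI0 dis) cards0 subn0 -dn.
    by rewrite leq_add2r; apply: contraTneq => ->; rewrite ltnn.
  have onesL : carried (link_face t d) (fun s => (link_face t d s)%:R : k).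
    by move=> s; case: (boolP (link_face t d s)) => // _; rewrite eqxx.
  have ones_nz : exists s, (link_face t d s)%:R != 0 :> k.
    have [s [sD ts sn]] := pure t tD; exists (s :\: t).
    rewrite (_ : link_face _ _ _ = true) ?oner_neq0 // /link_face inE; apply/andP; split; last first.
      by rewrite cardsD (setIidPr ts) sn -dn addnK.
    by rewrite disjoint_setD setDUK.
  have [x xP] := line_chains char2 (can_inj fK) top eL ecyc onesL (fundamental_closed dn) ones_nz.
  by exists (fun=> x) => s; rewrite xP (bigD1 tt) //= big1 ?addr0 // => -[].
by exists (w tt) => r okr; rewrite wP (bigD1 tt) //= okr mulr1 big1 ?addr0 // => -[].
Qed.

(** Passes from chains on the faces that contain [t] to chains on its link. *)
Definition descend t (c : {set 'I_N} -> K) s := if [disjoint s & t] then c (s :|: t) else 0.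

Lemma descend_closed t (c : {set 'I_N} -> K) :
  (forall r, t \subset r -> \sum_(v | v \notin r) c (v |: r) = 0) -> closed_chain (descend t c).
Proof.
move=> cyc r; rewrite /descend; have [dis|dis] := boolP [disjoint r & t]; last first.
  by apply: big1 => v _; rewrite disjoint_setU1 (negPf dis) andbF.
rewrite -[RHS](cyc (r :|: t)) ?subsetUr // [RHS]big_mkcond [LHS]big_mkcond.
apply: eq_bigr => v _; rewrite in_setU negb_or disjoint_setU1 dis andbT setUA.
by case: (v \in r); case: (v \in t).
Qed.

Lemma descend_carried t i (c : {set 'I_N} -> K) :
  (forall r, c r != 0 -> [/\ r \in (D : {set _}), t \subset r & #|r| = i]) ->
  carried (link_face t (i - #|t|)%N) (descend t c).
Proof.
move=> cD s; rewrite /descend; case: ifP => [dis /cD[sD _ <-]|]; last by rewrite eqxx.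
by rewrite /link_face inE dis sD cardsU (disjoint_setI0 dis) cards0 subn0 addnK eqxx.
Qed.

Lemma descendE t (c : {set 'I_N} -> K) r : t \subset r -> descend t c (r :\: t) = c r.
Proof.
by move=> tr; rewrite /descend disjoint_setD setDUK.
Qed.

Lemma sphere_exact i t (c : {set 'I_N} -> K) : t \in (D : {set _}) -> (i < n)%N ->
  (forall r, c r != 0 -> [/\ r \in (D : {set _}), t \subset r & #|r| = i]) ->
  (forall r, t \subset r -> \sum_(v | v \notin r) c (v |: r) = 0) ->
  exists2 w : {set 'I_N} -> K,
    (forall r, w r != 0 -> [/\ r \in (D : {set _}), t \subset r & #|r| = i.+1]) &
    (forall r, t \subset r -> c r = \sum_(v | v \notin r) w (v |: r)).
Proof.
move=> tD iln cD cyc; have [it|it] := ltnP i #|t|.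
  exists (fun=> 0) => [r|r tr]; first by rewrite eqxx.
  rewrite big1 //; apply/eqP; case: eqVneq => // /cD[_ _ ri].
  by have := subset_leq_card tr; rewrite ri leqNgt it.
have [|w wL wP] := exact_link tD _ (descend_carried cD) (descend_closed cyc).
  by rewrite subnK // neq_ltn iln.
exists (fun r => if t \subset r then w (r :\: t) else 0) => [r|r tr].
  case: ifP => [tr /wL/andP[]|]; last by rewrite eqxx.
  rewrite inE => /andP[_]; rewrite setDUK // => rD.
  rewrite cardsD (setIidPr tr) => /eqP E; split=> //.
  by rewrite -(subnK (subset_leq_card tr)) E -subSn // subnK // ltnW.
rewrite -(descendE c tr) wP [LHS]big_mkcond [RHS]big_mkcond; apply: eq_bigr => v _.
rewrite in_setD negb_and negbK (subset_trans tr) ?subsetUr //.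
have [vt|vt] := boolP (v \in t).
  rewrite (subsetP tr) //=; apply/eqP; case: eqVneq => // /wL; rewrite /link_face inE.
  by rewrite disjoint_setU1 vt.
have vDt : [set v] :\: t = [set v] by apply/setDidPl; rewrite disjoints1.
by rewrite /= setDUl vDt.
Qed.

Lemma sphere_top t (c : {set 'I_N} -> K) : t \in (D : {set _}) ->
  (forall r, c r != 0 -> [/\ r \in (D : {set _}), t \subset r & #|r| = n]) ->
  (forall r, t \subset r -> \sum_(v | v \notin r) c (v |: r) = 0) ->
  exists e, forall r, r \in (D : {set _}) -> t \subset r -> #|r| = n -> c r = e.
Proof.
move=> tD cD cyc; have tn : (#|t| <= n)%N by have [[Dle _] _] := hD; exact: Dle.
have [|e eP] := top_link tD _ (descend_carried cD) (descend_closed cyc); first by rewrite subnK.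
exists e => r rD tr rn; rewrite -(descendE c tr); apply: eP.
by rewrite /link_face inE disjoint_setD setDUK // rD cardsD (setIidPr tr) rn eqxx.
Qed.

End OverExtension.
End SphereChains.

(** * Derivations of a field of fractions *)

Section QuotientRule.
Variable F : fieldType.

Lemma quotient_ruleD (p q p' q' dp dq dp' dq' : F) : q != 0 -> q' != 0 ->
    ((dp * q' + p * dq' + (dp' * q + p' * dq)) * (q * q') -
     (p * q' + p' * q) * (dq * q' + q * dq')) / (q * q') ^+ 2 =
    (dp * q - p * dq) / q ^+ 2 + (dp' * q' - p' * dq') / q' ^+ 2.
Proof. by move=>q0 q'0; field; rewrite q0 q'0. Qed.

Lemma quotient_ruleM (p q p' q' dp dq dp' dq' : F) : q != 0 -> q' != 0 ->
    ((dp * p' + p * dp') * (q * q') - p * p' * (dq * q' + q * dq')) / (q * q') ^+ 2 =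
    (dp * q - p * dq) / q ^+ 2 * (p' / q') + p / q * ((dp' * q' - p' * dq') / q' ^+ 2).
Proof. by move=>q0 q'0; field; rewrite q0 q'0. Qed.

End QuotientRule.

Section FractionDerivation.
Variables (R : idomainType) (d : R -> R).
Hypothesis dD : {morph d : x y / x + y}.
Hypothesis dM : forall x y, d (x * y) = d x * y + x * d y.
Local Notation F := {fraction R}.
Local Notation "x %:F" := (tofrac x).

Lemma fraction_quotient (x : F) : exists p : R * R, p.2 != 0 /\ x = p.1%:F / p.2%:F.
Proof.
elim/quotW: x => r; exists (\n_r, \d_r); split; first exact: denom_ratioP.
have dF : (\d_r)%:F != 0 by rewrite tofrac_eq0 denom_ratioP.
apply: (mulIf dF); rewrite divfK //; unlock tofrac; rewrite -[LHS]FracField.pi_mul.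
apply/eqmodP; rewrite /= FracField.equivfE /FracField.mulf.
by rewrite !numden_Ratio ?(oner_eq0, mulf_neq0, denom_ratioP) // !mulr1 mulrC.
Qed.

Definition quot_rep x := projT1 (cid (fraction_quotient x)).

Definition frac_der (x : F) : F :=
  let p := quot_rep x in
  ((d p.1)%:F * p.2%:F - p.1%:F * (d p.2)%:F) / p.2%:F ^+ 2.

Lemma frac_derE (n m : R) : m != 0 ->
  frac_der (n%:F / m%:F) = ((d n)%:F * m%:F - n%:F * (d m)%:F) / m%:F ^+ 2.
Proof.
move=> m0; rewrite /frac_der /quot_rep; case: cid => -[p q] /= [q0 npq].
have nz (x : R) : x != 0 -> x%:F != 0 by rewrite tofrac_eq0.
have E : n * q = p * m.
  apply/eqP; rewrite -tofrac_eq !tofracM; apply/eqP.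
  by rewrite -[n%:F](divfK (nz _ m0)) npq mulrAC divfK ?nz // mulrC.
have E' : d n * q + n * d q = d p * m + p * d m by rewrite -!dM E.
apply/eqP; rewrite eqr_div ?expf_neq0 ?nz // -!tofracXn -!tofracM -!tofracB -!tofracM tofrac_eq.
rewrite -subr_eq0; apply/eqP.
have -> : (d p * q - p * d q) * m ^+ 2 - (d n * m - n * d m) * q ^+ 2 =
  (n * q - p * m) * (d m * q + d q * m) - m * q * (d n * q + n * d q - (d p * m + p * d m)) by ring.
by rewrite E E' !subrr mul0r mulr0 subrr.
Qed.

Lemma frac_der_tofrac (n : R) : frac_der n%:F = (d n)%:F.
Proof.
have d1 : d 1 = 0.
  by apply/eqP; rewrite -(inj_eq (addrI (d 1))) addr0 -{1}[d 1]mulr1 -{2}[d 1]mul1r -dM mulr1.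
rewrite -[n%:F]divr1 -tofrac1 frac_derE ?oner_neq0 // d1 tofrac0 tofrac1.
by rewrite mulr0 subr0 expr1n divr1 mulr1.
Qed.

Lemma frac_derD : {morph frac_der : x y / x + y}.
Proof.
move=> x y; have [[p q] /= [q0 ->]] := fraction_quotient x.
have [[p' q'] /= [q'0 ->]] := fraction_quotient y.
have nz (z : R) : z != 0 -> z%:F != 0 by rewrite tofrac_eq0.
rewrite addf_div ?nz // -!tofracM -tofracD !frac_derE ?mulf_neq0 // dD !dM.
by rewrite -quotient_ruleD ?nz // !(tofracD, tofracM).
Qed.

Lemma frac_derM x y : frac_der (x * y) = frac_der x * y + x * frac_der y.
Proof.
have [[p q] /= [q0 ->]] := fraction_quotient x.
have [[p' q'] /= [q'0 ->]] := fraction_quotient y.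
have nz (z : R) : z != 0 -> z%:F != 0 by rewrite tofrac_eq0.
rewrite mulf_div -!tofracM !frac_derE ?mulf_neq0 // !dM.
by rewrite -quotient_ruleM ?nz // !(tofracD, tofracM).
Qed.

End FractionDerivation.

(** * Monomials and polynomials *)

Section Monomials.
Variable N : nat.
Implicit Types (H M y z : 'X_{1..N}).

Lemma mnm_seq M : exists2 l : seq 'I_N, size l = mdeg M & M = (\sum_(v <- l) U_(v))%MM.
Proof.
have [d] := ubnP (mdeg M); elim: d M => // d IH M; rewrite ltnS => Md.
have [M0|M0] := eqVneq M 0%MM.
  by exists [::]; rewrite ?big_nil // M0 mdeg0.
have [v Mv] : exists v, M v != 0%N.
  have [//|no] := pselect (exists v, M v != 0%N).
  case/eqP: M0; apply/mnmP => v; rewrite mnm0E; apply/eqP.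
  by case: eqVneq => // Mv; case: no; exists v.
have vM : (U_(v) <= M)%MM by rewrite lemU inE.
have dM := mdegB vM; rewrite mdeg1 add1n in dM.
have [|l sl lE] := IH (M - U_(v))%MM; first by rewrite -dM.
by exists (v :: l); rewrite /= ?sl // big_cons -lE addmC submK.
Qed.

Lemma mnm_split M k : (k <= mdeg M)%N -> exists z z', [/\ mdeg z = k, mdeg z' = (mdeg M - k)%N & M = (z + z')%MM].
Proof.
have [l sl Ml] := mnm_seq M; rewrite -sl => kl.
have deg (l' : seq 'I_N) : mdeg (\sum_(v <- l') U_(v))%MM = size l'.
  by rewrite mdeg_sum -sum1_size; apply: eq_bigr => i _; rewrite mdeg1.
exists (\sum_(v <- take k l) U_(v))%MM, (\sum_(v <- drop k l) U_(v))%MM.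
by rewrite !deg size_takel // size_drop -big_cat cat_take_drop.
Qed.

Lemma mnm_expI n M : mdeg M = n -> exists I : 'I_n -> 'I_N, expI I (enum 'I_n) = M.
Proof.
have [l sl Ml] := mnm_seq M; rewrite -sl => /eqP ln.
exists (tnth (Tuple ln)); rewrite Ml /expI big_enum /=.
by rewrite -(big_tuple _ _ (Tuple ln) xpredT (fun v => U_(v)%MM)).
Qed.

End Monomials.

Section Polynomials.
Variables (R : comNzRingType) (N : nat).
Implicit Types (p q : {mpoly R[N]}) (al mu : 'X_{1..N}).

Lemma mcoeffM_X p mu al :
  (p * 'X_[mu])@_al = if (mu <= al)%MM then p@_(al - mu)%MM else 0.
Proof.
case: ifP => [ma|ma]; first by rewrite -{1}(submK ma) addmC mcoeffMX.
rewrite {1}[p]mpolyE mulr_suml raddf_sum big1 // => k _ /=.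
rewrite -scalerAl -mpolyXD mcoeffZ mcoeffX; case: eqP => [kE|_]; last by rewrite mulr0.
by rewrite -kE lem_addl in ma.
Qed.


End Polynomials.

(** * The degree functional and anisotropy *)

Section Degree.
Variables (K : fieldType) (char2 : 2%N \in [pchar K]) (n N : nat).
Variable a : 'I_n -> 'I_N -> K.
Variable der : 'I_n -> 'I_N -> K -> K.
Hypothesis derD : forall i v, {morph der i v : x y / x + y}.
Hypothesis derM : forall i v x y, der i v (x * y) = der i v x * y + x * der i v y.
Hypothesis der_coef : forall i v i' v',
  der i v (a i' v') = ((i == i') && (v == v'))%:R.

Variable D : {set {set 'I_N}}.
Implicit Types (r s t : {set 'I_N}) (H m al : 'X_{1..N}) (f g p q : {mpoly K[N]}).
Hypothesis Dsub : forall s t, s \in D -> t \subset s -> t \in D.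
Hypothesis D0 : set0 \in D.
Hypothesis Dpure : forall t, t \in D -> exists s, [/\ s \in D, t \subset s & #|s| = n].
Hypothesis wallD : forall r, #|r|.+1 = n -> \sum_(v | v \notin r) ((v |: r) \in D)%:R = 0 :> K.

Local Notation rows := (enum 'I_n).

Lemma size_rows : size rows = n. Proof. by rewrite size_enum_ord. Qed.

Lemma Phi_out l r H v : #|r| = size l -> mdeg H = size l -> v \notin r -> H v != 0%N ->
  Phi a l r H = 0.
Proof.
case: l => [|i l] cr dH vr Hv.
  by move/eqP: dH; rewrite mdeg_eq0 => /eqP H0; rewrite H0 mnm0E eqxx in Hv.
by rewrite PhiE (@Xi_out _ _ _ _ l r H v) ?mul0r.
Qed.

Definition facet s := (s \in D) && (#|s| == n).

Definition Psi_mon H := \sum_(s | facet s) Phi a rows s H.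

(** The degree map on the part of degree [n]: the sum of the contributions of
    the facets.  Each is an evaluation at a point, which makes it linear. *)
Definition Psi f : K := \sum_(s | facet s)
  (pihomog mdeg n f).@[cof a (behead rows) s]
    / (minor a rows s * \prod_(u in s) cof a (behead rows) s u).

Lemma PsiD f g : Psi (f + g) = Psi f + Psi g.
Proof. by rewrite -big_split; apply: eq_bigr => s _; rewrite pihomogD mevalD mulrDl. Qed.

Lemma PsiZ c f : Psi (c *: f) = c * Psi f.
Proof.
by rewrite mulr_sumr; apply: eq_bigr => s _; rewrite linearZ mevalZ mulrA.
Qed.

Lemma Psi0 : Psi 0 = 0.
Proof. by rewrite -(scale0r 0) PsiZ mul0r. Qed.

Lemma Psi_sum (T : Type) (s : seq T) (P : pred T) (F : T -> {mpoly K[N]}) :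
  Psi (\sum_(x <- s | P x) F x) = \sum_(x <- s | P x) Psi (F x).
Proof. by apply: big_morph; [exact: PsiD | exact: Psi0]. Qed.

Lemma PsiX m : Psi 'X_[m] = if mdeg m == n then Psi_mon m else 0.
Proof.
rewrite /Psi pihomogX; case: ifP => _.
  by apply: eq_bigr => s _; rewrite mevalX.
by apply: big1 => s _; rewrite meval0 mul0r.
Qed.

Lemma PsiE f g : Psi (f * g) = \sum_(m <- msupp f) f@_m * Psi ('X_[m] * g).
Proof.
rewrite {1}[f]mpolyE mulr_suml Psi_sum; apply: eq_bigr => m _.
by rewrite -scalerAl PsiZ.
Qed.

Lemma Psi_mon_nonface m : mdeg m = n -> msup m \notin D -> Psi_mon m = 0.
Proof.
move=> dm mD; apply: big1 => s /andP[sD /eqP sn].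
have /subsetPn[v vm vs] : ~~ (msup m \subset s) by apply: contraNN mD; exact: Dsub.
by apply: (@Phi_out _ _ _ v); rewrite ?size_rows //; rewrite inE in vm.
Qed.

Lemma Psi_nonface f : (forall al, msup al \in D -> f@_al = 0) -> Psi f = 0.
Proof.
move=> f0; rewrite [f]mpolyE Psi_sum big1 // => m _; rewrite PsiZ PsiX.
have [mD|mD] := boolP (msup m \in D); first by rewrite f0 ?mul0r.
by case: eqP => [dm|_]; rewrite ?Psi_mon_nonface ?mulr0.
Qed.

Definition thetap i : {mpoly K[N]} := \sum_(j < N) a i j *: 'X_j.

(** Each wall occurs once for every facet that contains it, hence an even
    number of times. *)
Lemma wall_cancel (g : {set 'I_N} -> K) : \sum_(s | facet s) \sum_(v in s) g (s :\ v) = 0.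
Proof.
rewrite (exchange_big_dep predT) //=.
transitivity (\sum_(v : 'I_N) \sum_(r : {set 'I_N} | v \notin r) (facet (v |: r))%:R * g r).
  apply: eq_bigr => v _.
  rewrite (reindex_onto (fun r => v |: r) (fun s => s :\ v)) /=; last first.
    by move=> s /andP[_ vs]; rewrite setD1K.
  rewrite (eq_bigl (fun r => (v \notin r) && facet (v |: r))).
    rewrite big_mkcondr; apply: eq_bigr => r vr; rewrite setU1K //.
    by case: ifP; rewrite (mul1r, mul0r).
  move=> r; rewrite setU11 andbT andbC; have [vr|vr] /= := boolP (v \in r).
    by apply/negP => /andP[/eqP/setP/(_ v)]; rewrite !inE eqxx vr.
  by rewrite setU1K // eqxx.
rewrite (exchange_big_dep predT) //= big1 // => r _; rewrite -mulr_suml.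
have [rn|rn] := eqVneq #|r|.+1 n.
  rewrite (eq_bigr (fun v => ((v |: r) \in D)%:R)) ?wallD ?mul0r // => v vr.
  by rewrite /facet cardsU1 vr add1n rn eqxx andbT.
rewrite big1 ?mul0r // => v vr; rewrite /facet cardsU1 vr add1n (negPf rn) andbF //.
Qed.

(** At the point of a facet all the [theta_i] vanish but the first.  The first
    one cancels the minor in the denominator and leaves the degree map of the
    boundary of the facet for the other rows; by interpolation this is a sum
    over walls, which cancels. *)
Lemma Psi_theta f i : Psi (f * thetap i) = 0.
Proof.
rewrite PsiE big1 // => m _; rewrite /thetap [X in Psi X]mulr_sumr Psi_sum.
transitivity (f@_m * \sum_(j < N) a i j * Psi 'X_[m + U_(j)]).
  by congr (_ * _); apply: eq_bigr => j _; rewrite -scalerAr PsiZ mpolyXD.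
have [dm|dm] := eqVneq (mdeg m).+1 n; last first.
  by rewrite big1 ?mulr0 // => j _; rewrite PsiX mdegD mdeg1 addn1 (negPf dm) mulr0.
have [i0 [l rE]] : exists i0 l, rows = i0 :: l.
  case E: rows => [|i0 l]; last by exists i0, l.
  by have := size_rows; rewrite E => /= n0; move: dm; rewrite -[RHS]n0.
have ul : uniq (i0 :: l) by rewrite -rE enum_uniq.
have sl : (size l).+1 = n by have := size_rows; rewrite rE.
have dl : mdeg m = size l by apply: succn_inj; rewrite dm sl.
transitivity (f@_m * ((i == i0)%:R * \sum_(s | facet s) Xi a l s m)).
  congr (_ * _); under eq_bigr => j _ do rewrite PsiX mdegD mdeg1 addn1 dm eqxx mulr_sumr.
  rewrite exchange_big mulr_sumr; apply: eq_bigr => s /andP[sD /eqP sn] /=.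
  have ssl : #|s| = (size l).+1 by rewrite sl.
  rewrite rE; under eq_bigr => j _ do rewrite PhiE XiD monU -[X in _ * X]mulrA mulrA.
  rewrite -mulr_suml (bigID (mem s)) /= [X in _ + X]big1 ?addr0 => [|j js]; last first.
    by rewrite cof_out ?mulr0.
  have mnz := minor_neq0 derD derM der_coef ul (ssl : #|s| = size (i0 :: l)).
  have [->|ne] := eqVneq i i0.
    by rewrite mul1r -[X in X * _]/(minor a (i0 :: l) s) mulrC divfK.
  rewrite [X in X * _](_ : _ = 0) ?mul0r //; apply: minor_row => //.
  by have := mem_enum 'I_n i; rewrite rE inE (negPf ne).
rewrite [X in _ * (_ * X)](_ : _ = 0) ?mulr0 //.
rewrite -[RHS](wall_cancel (fun r => Phi a l r m)); apply: eq_bigr => s /andP[sD /eqP sn].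
apply: (lagrange char2 derD derM der_coef); rewrite ?sl //; by case/andP: ul.
Qed.

(** Only one facet contributes, by the inverse of its minor. *)
Lemma Psi_facet s : facet s -> Psi 'X_[ind s] != 0.
Proof.
move=> fs; have /andP[sD /eqP sn] := fs.
rewrite PsiX mdeg_ind sn eqxx /Psi_mon (bigD1 s) //= big1 ?addr0 => [|s' /andP[/andP[_ /eqP s'n] ne]].
  have srows : #|s| = size rows by rewrite size_rows.
  have mnz := minor_neq0 derD derM der_coef (enum_uniq 'I_n) srows.
  rewrite /Phi; have -> : mon (cof a (behead rows) s) (ind s) =
      \prod_(u in s) cof a (behead rows) s u.
    rewrite [RHS]big_mkcond; apply: eq_bigr => v _.
    by rewrite mnmE; case: ifP.
  have pnz : \prod_(u in s) cof a (behead rows) s u != 0.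
    apply/prodf_neq0 => u us; apply: (cof_neq0 derD derM der_coef) => //.
      by have := enum_uniq 'I_n; case: rows => //= ? ? /andP[].
    have n0 : (0 < n)%N by rewrite -sn card_gt0; apply/set0Pn; exists u.
    by rewrite size_behead size_rows sn prednK.
  by rewrite mulf_neq0 // invr_eq0 mulf_neq0.
have /subsetPn[v vs vs'] : ~~ (s \subset s').
  by apply: contra ne => ss'; rewrite eq_sym eqEcard ss' sn s'n leqnn.
by apply: (@Phi_out _ _ _ v); rewrite ?size_rows ?mdeg_ind // mnmE vs.
Qed.

(** The coefficients of [q^2] are squares, hence constants, and the
    differential rule for monomials gives a sum of squares, which is the
    square of a sum. *)
Lemma derI_Psi I q z d : q \is d.-homog -> (d + d + mdeg z)%N = n ->
  derI der I rows (Psi (q ^+ 2 * 'X_[z])) =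
    if evenm (z + expI I rows)%MM then Psi (q * 'X_[halfm (z + expI I rows)]) ^+ 2 else 0.
Proof.
move=> hq dn.
have char2p : 2%N \in [pchar {mpoly K[N]}] by exact: rmorph_pchar (mpolyC N (R := K)) _ char2.
have q2 : q ^+ 2 = \sum_(m <- msupp q) q@_m ^+ 2 *: 'X_[m + m].
  rewrite {1}[q]mpolyE sqr_sum_pchar2 //; apply: eq_bigr => m _.
  by rewrite exprZn mpolyXD expr2.
rewrite q2 mulr_suml Psi_sum derI_sum //.
have term m : m \in msupp q ->
    derI der I rows (Psi (q@_m ^+ 2 *: 'X_[m + m] * 'X_[z])) =
    if evenm (z + expI I rows)%MM then
      (q@_m * Psi ('X_[m] * 'X_[halfm (z + expI I rows)])) ^+ 2 else 0.
  move=> mq; have dm : mdeg m = d by exact: (dhomogP _ _ _ hq).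
  rewrite -scalerAl PsiZ derI_sqM // -!mpolyXD !PsiX !mdegD dm dn eqxx derI_sum //.
  under eq_bigr => s /andP[sD /eqP sn].
    rewrite (derI_Phi char2 derD derM der_coef) ?enum_uniq ?size_rows // ?mdegD ?dm //.
    rewrite -addmA [(m + m + _)%MM]addmC evenmD2 halfmD2.
    over.
  case: ifP => ev; last by rewrite big1 ?mulr0.
  have dh : mdeg (halfm (z + expI I rows)%MM) = (n - d)%N.
    apply: mdeg_halfm => //; rewrite mdegD mdeg_expI size_rows -dn; lia.
  rewrite dh subnKC; last by rewrite -dn -addnA leq_addr.
  rewrite eqxx exprMn addmC /Psi_mon sqr_sum_pchar2 //.
rewrite big_seq (eq_bigr _ term) -big_seq; case: ifP => ev; last by rewrite big1.
by rewrite PsiE sqr_sum_pchar2.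
Qed.


(** Since the square submatrix of a facet is injective, so that a vector
    killed by the rows vanishes on the facet, its rows span the coordinate
    forms of that facet. *)
Lemma face_dual_family t : t \in D -> dual_family a t.
Proof.
move=> tD v vt; have [s [sD ts sn]] := Dpure tD.
pose A : 'M[K]_(n, N) := \matrix_(i, u) (a i u *+ (u \in s)).
have /submxP[lam lamE] : ((delta_mx 0 v : 'rV[K]_N) <= A)%MS.
  rewrite submxE; apply/eqP/rowP => j; rewrite -rowE mxE [RHS]mxE.
  have srows : #|s| = size rows by rewrite size_rows.
  apply: (ker_minor0 char2 derD derM der_coef (enum_uniq 'I_n) srows
            (y := fun u => cokermx A u j)).
  - move=> i _; have := congr1 (fun B : 'M_(n, N) => B i j) (mulmx_coker A).
    rewrite mxE [RHS]mxE => E; rewrite -[RHS]E big_mkcond; apply: eq_bigr => u _.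
    by rewrite [A _ _]mxE; case: ifP; rewrite ?mulr1n // mulr0n mul0r.
  - exact: (subsetP ts).
exists (fun i => lam 0 i) => u ut.
have := congr1 (fun B : 'rV_N => B 0 u) lamE; rewrite !mxE eqxx /= => ->.
by apply: eq_bigr => i _; rewrite mxE (subsetP ts) // mulr1n.
Qed.

Hypothesis exactD : forall i t (c : {set 'I_N} -> K), t \in D -> (i < n)%N ->
  (forall r, c r != 0 -> [/\ r \in D, t \subset r & #|r| = i]) ->
  (forall r, t \subset r -> \sum_(v | v \notin r) c (v |: r) = 0) ->
  exists2 w : {set 'I_N} -> K,
    (forall r, w r != 0 -> [/\ r \in D, t \subset r & #|r| = i.+1]) &
    (forall r, t \subset r -> c r = \sum_(v | v \notin r) w (v |: r)).
Hypothesis topD : forall t (c : {set 'I_N} -> K), t \in D ->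
  (forall r, c r != 0 -> [/\ r \in D, t \subset r & #|r| = n]) ->
  (forall r, t \subset r -> \sum_(v | v \notin r) c (v |: r) = 0) ->
  exists e, forall r, r \in D -> t \subset r -> #|r| = n -> c r = e.

(** [f] lies in the ideal generated by the [theta_i] and the monomials of
    nonfaces: a polynomial is in the ideal of nonfaces when its coefficients
    on the monomials supported on faces vanish. *)
Definition in_ideal f := exists q : 'I_n -> {mpoly K[N]},
  forall al, msup al \in D -> (f - \sum_i q i * thetap i)@_al = 0.

Lemma in_ideal_mul f g : in_ideal f -> in_ideal (f * g).
Proof.
move=> [q fq]; exists (fun i => q i * g) => al alD.
have -> : f * g - \sum_i q i * g * thetap i = (f - \sum_i q i * thetap i) * g.
  rewrite mulrBl mulr_suml; congr (_ - _); apply: eq_bigr => i _; by rewrite mulrAC.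
rewrite mcoeffM big1 // => k /eqP alk; rewrite fq ?mul0r //.
apply: Dsub alD _; have -> : msup al = msup (k.1 + k.2)%MM by congr msup.
by rewrite msupD subsetUl.
Qed.

Lemma Psi_in_ideal f : in_ideal f -> Psi f = 0.
Proof.
move=> [q fq]; rewrite -[f](subrK (\sum_i q i * thetap i)) PsiD Psi_nonface //.
by rewrite Psi_sum big1 ?add0r // => i _; exact: Psi_theta.
Qed.

Lemma coef_in_ideal f d : f \is d.-homog -> in_ideal_coef a D (fun al => f@_al) -> in_ideal f.
Proof.
move=> hf [h fh].
(* The coefficients of [h] are truncated to the one degree that matters, which
   makes them polynomials. *)
pose E i (al : 'X_{1..N}) : K := if (mdeg al).+1 == d then h i al else 0.
pose q i : {mpoly K[N]} := \sum_(al : 'X_{1..N < d}) E i al *: 'X_[al].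
have qE i al : (q i)@_al = E i al.
  have [lt|ge] := ltnP (mdeg al) d; first exact: mcoeff_mpoly.
  rewrite /E ifF; last by apply/negbTE; rewrite neq_ltn ltnS ge orbT.
  rewrite raddf_sum big1 // => be _ /=; rewrite mcoeffZ mcoeffX.
  case: eqP => [E1|_]; last by rewrite mulr0.
  by rewrite -E1 leqNgt bmdeg in ge.
exists q => al alD; rewrite mcoeffB raddf_sum /= fh //.
apply/eqP; rewrite subr_eq0; apply/eqP; have [dal|dal] := eqVneq (mdeg al) d.
  apply: eq_bigr => i _; rewrite /thetap mulr_sumr raddf_sum /= [LHS]big_mkcond.
  apply: eq_bigr => u _; rewrite -scalerAr mcoeffZ mcoeffM_X lemU inE.
  case: ifP => alu; last by rewrite mulr0.
  have ual : (U_(u) <= al)%MM by rewrite lemU inE.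
  by rewrite qE /E -dal (mdegB ual) mdeg1 eqxx.
rewrite -fh // (dhomog_nemf_coeff hf dal) big1 // => i _.
rewrite /thetap mulr_sumr raddf_sum big1 //= => u _; rewrite -scalerAr mcoeffZ mcoeffM_X.
case: ifP => ual; last by rewrite mulr0.
by rewrite qE /E -add1n -(mdeg1 u) -mdegB // (negPf dal) mulr0.
Qed.

(** Poincare duality.  If [q] were nonzero in the cohomology ring, some
    [x_s + e x_t q] with [x_s] a facet monomial would vanish there, although
    [Psi] does not kill it. *)
Lemma Psi_nondegenerate q d : (d <= n)%N -> q \is d.-homog ->
  (forall y, mdeg y = (n - d)%N -> Psi (q * 'X_[y]) = 0) -> in_ideal q.
Proof.
move=> dn hq q0; apply: contrapT => nJ.
have [||t [tD tn tP]] := dual_faces char2 Dsub face_dual_family exactD Dpure wallD topD dn (G := fun al => q@_al).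
- by move=> al; apply: contra_neq_eq => /(dhomog_nemf_coeff hq).
- by move=> /(coef_in_ideal hq).
have [s [sD _ sn]] := Dpure D0.
have fs : facet s by rewrite /facet sD sn eqxx.
have [|e] := tP (fun al => 'X_[ind s]@_al).
  by move=> al; rewrite mcoeffX; case: (eqVneq (ind s) al) => [<-|_]; rewrite ?mdeg_ind // eqxx.
pose f : {mpoly K[N]} := 'X_[ind s] + e *: (q * 'X_[ind t]).
have -> : (fun al => 'X_[ind s]@_al + e * shift (ind t) (fun al => q@_al) al) =
          (fun al => f@_al).
  by apply/funext => al; rewrite mcoeffD mcoeffZ mcoeffM_X.
have hf : f \is n.-homog.
  apply: rpredD; first by rewrite dhomogX -sn; apply/eqP; exact: mdeg_ind.
  apply: rpredZ; rewrite -(subnKC dn) -tn -mdeg_ind.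
  by apply: dhomogM => //; rewrite dhomogX; apply/eqP.
move=> /(coef_in_ideal hf)/Psi_in_ideal; rewrite PsiD PsiZ q0 ?mdeg_ind // mulr0 addr0.
by move/eqP; rewrite (negPf (Psi_facet fs)).
Qed.

Definition sumX : {mpoly K[N]} := \sum_(j < N) 'X_j.

Lemma sumX_homog : sumX \is 1.-homog.
Proof. by apply: rpred_sum => j _; rewrite dhomogX; apply/eqP; exact: mdeg1. Qed.

(** The heart of the anisotropy.  For a monomial [y] of complementary degree,
    split [y^2], or [y^2 / x_w] when [s] is odd, as [x^z x_I].  The derivative
    along [I] of [Psi (p^2 l^s x^z) = 0] is a sum of squares in which only
    the term with root [y] survives, so [Psi (p l^(s/2) y) = 0]. *)
Lemma halve_power p (m s : nat) : p \is m.-homog -> (s + m.*2 <= n)%N ->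
  in_ideal (p ^+ 2 * sumX ^+ s) -> in_ideal (p * sumX ^+ s./2).
Proof.
move=> hp smn Jp; pose q := p * sumX ^+ s./2; pose d := (m + s./2)%N.
have s2 := odd_double_half s.
have hq : q \is d.-homog.
  by apply: dhomogM => //; have := dhomogMn s./2 sumX_homog; rewrite mul1n.
have pq : p ^+ 2 * sumX ^+ s = q ^+ 2 * sumX ^+ odd s.
  by rewrite /q exprMn -[RHS]mulrA -exprM muln2 -exprD addnC s2.
have dn : (d <= n)%N by rewrite /d; lia.
apply: (Psi_nondegenerate dn hq) => y dy.
have P0 z : Psi (q ^+ 2 * sumX ^+ odd s * 'X_[z]) = 0.
  by rewrite -pq; apply: Psi_in_ideal; exact: in_ideal_mul.
have evenyy : evenm (y + y)%MM by apply/forallP => v; rewrite mnmDE addnn odd_double.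
have halfyy : halfm (y + y)%MM = y by apply/mnmP => v; rewrite mnmE mnmDE addnn doubleK.
have dyy : mdeg (y + y)%MM = (n - d + (n - d))%N by rewrite mdegD dy.
case os: (odd s) P0 s2 => /= P0 s2.
  (* One factor [l] is left over; only its term [x_w] can complete a square. *)
  have [w yw] : exists w, y w != 0%N.
    apply: contrapT => no; have: mdeg y = 0%N.
      rewrite mdegE big1 // => w _; apply/eqP; case: eqVneq => // yw.
      by case: no; exists w.
    by rewrite dy /d; lia.
  have wyy : (U_(w) <= y + y)%MM by rewrite lemU inE mnmDE addn_eq0 negb_and yw.
  have dyw := mdegB wyy; rewrite mdeg1 dyy in dyw.
  have [|z [z' [dz dz' zz']]] := @mnm_split _ (y + y - U_(w))%MM (n - m.*2 - s)%N.
    by move: dyw; rewrite /d; lia.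
  have [I IE] : exists I : 'I_n -> 'I_N, expI I rows = z'.
    by apply: mnm_expI; rewrite dz' /d; move: dyw; rewrite /d; lia.
  have yyE : (y + y)%MM = (z + expI I rows + U_(w))%MM by rewrite IE -zz' submK.
  have := P0 z; rewrite expr1 /sumX mulr_sumr mulr_suml Psi_sum.
  move=> /(congr1 (derI der I rows)); rewrite derI0 // derI_sum // (bigD1 w) //=.
  have dd j : (d + d + mdeg (z + U_(j))%MM)%N = n.
    by rewrite mdegD mdeg1 dz /d; lia.
  rewrite [X in _ + X]big1 => [|j jw]; last first.
    rewrite -mulrA -mpolyXD [(U_(j) + z)%MM]addmC (derI_Psi _ hq (dd j)) ifF //.
    apply/negP => /forallP/(_ w); have := congr1 (fun M : 'X_{1..N} => odd (M w)) yyE.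
    rewrite !mnmDE !mnm1E eqxx (negPf jw) !oddD /= !addbF addbb.
    by case: (odd (z w)); case: (odd _).
  rewrite addr0 -mulrA -mpolyXD [(U_(w) + z)%MM]addmC (derI_Psi _ hq (dd w)).
  by rewrite -addmA [(U_(w) + _)%MM]addmC addmA -yyE evenyy halfyy => /eqP; rewrite sqrf_eq0 => /eqP.
have [|z [z' [dz dz' zz']]] := @mnm_split _ (y + y)%MM (n - m.*2 - s)%N.
  by rewrite dyy /d; lia.
have [I IE] : exists I : 'I_n -> 'I_N, expI I rows = z'.
  by apply: mnm_expI; rewrite dz' dyy /d; lia.
have := P0 z; rewrite expr0 mulr1 => /(congr1 (derI der I rows)); rewrite derI0 //.
have dd : (d + d + mdeg z)%N = n by rewrite dz /d; lia.
by rewrite (derI_Psi _ hq dd) IE -zz' evenyy halfyy => /eqP; rewrite sqrf_eq0 => /eqP.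
Qed.

(** Halving the exponent and multiplying by [p] gives the hypothesis with a
    smaller exponent of [l]. *)
Lemma anisotropic_power p (m s : nat) : p \is m.-homog -> (s + m.*2 <= n)%N ->
  in_ideal (p ^+ 2 * sumX ^+ s) -> in_ideal p.
Proof.
elim/ltn_ind: s => s IH hp smn Jp; have Jh := halve_power hp smn Jp.
have [s0|s0] := eqVneq s 0%N; first by move: Jh; rewrite s0 mulr1.
have := in_ideal_mul p Jh; rewrite mulrAC -expr2.
by apply: IH => //; lia.
Qed.

End Degree.

(** * The generic cohomology ring *)

Lemma ideal_pi_eq0 (R : comNzRingType) (J : idealr R) (x : R) :
  \pi_({ideal_quot J}) x = 0 <-> x \in J.
Proof.
rewrite -[x in x \in _]subr0 Quotient.idealrBE -[0 in X in X <-> _](rmorph0 (\pi_{ideal_quot J})).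
by split=> [->|/eqP].
Qed.

(** Membership in an ideal of a quotient ring, read upstairs. *)
Lemma ideal_pi_span (R : comNzRingType) (J : idealr R) n (t : 'I_n -> R) (x : R) :
  (exists c : 'I_n -> {ideal_quot J},
     \pi_({ideal_quot J}) x = \sum_(i | predT i) c i * \pi_({ideal_quot J}) (t i)) <->
  (exists q : 'I_n -> R, x - \sum_i q i * t i \in J).
Proof.
split=> [[c xc]|[q /ideal_pi_eq0]].
  exists (fun i => repr (c i)); apply/ideal_pi_eq0.
  rewrite rmorphB rmorph_sum /= xc; apply/eqP; rewrite subr_eq0; apply/eqP.
  by apply: eq_bigr => i _; rewrite rmorphM /= reprK.
move=> /eqP; rewrite rmorphB rmorph_sum subr_eq0 => /eqP /= xq.
exists (fun i => \pi_({ideal_quot J}) (q i)); rewrite xq.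
by apply: eq_bigr => i _; rewrite rmorphM.
Qed.

Lemma pi_pi_monomial (R : comNzRingType) (J : idealr R) (J' : idealr {ideal_quot J})
    (x y : R) d e :
  \pi_({ideal_quot J'}) (\pi_({ideal_quot J}) (x ^+ d * y ^+ e)) =
  \pi_({ideal_quot J'}) (\pi_({ideal_quot J}) x) ^+ d *
  \pi_({ideal_quot J'}) (\pi_({ideal_quot J}) y) ^+ e.
Proof. by rewrite !rmorphM !rmorphXn. Qed.

Section Presentation.
Variables (k : fieldType) (n N : nat) (D : scomplex N).
Local Notation K := (coef_field k n N).
Local Notation a := (@coef k n N).
Implicit Types (f : {mpoly K[N]}) (s : {set 'I_N}).

Lemma prod_vars s : \prod_(j in s) 'X_j = 'X_[ind s] :> {mpoly K[N]}.
Proof.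
rewrite mpolyXE_id big_mkcond; apply: eq_bigr => j _; rewrite mnmE.
by case: ifP => _; rewrite ?expr1 ?expr0.
Qed.

Lemma SR_idealP f : f \in SR_ideal (k:=k) (n:=n) D <->
  forall al, msup al \in (D : {set _}) -> f@_al = 0.
Proof.
split=> [/ideal_genP[c ->] al alD | f0].
  rewrite raddf_sum big1 // => s sD /=; rewrite prod_vars mcoeffM_X.
  case: ifP => // /mnm_lepP sal; case/negP: sD; apply: face_sub alD _.
  apply/subsetP => v vs; rewrite inE; have := sal v; rewrite mnmE vs.
  by case: (al v).
apply/ideal_genP.
exists (fun s => \sum_(m <- msupp f | msup m == s) f@_m *: 'X_[m - ind s]).
transitivity (\sum_(s | s \notin (D : {set _})) \sum_(m <- msupp f | msup m == s) f@_m *: 'X_[m]).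
  rewrite (exchange_big_dep predT) //= {1}[f]mpolyE; apply: eq_bigr => m _.
  have [mD|mD] := boolP (msup m \in (D : {set _})).
    by rewrite f0 // scale0r big1 // => s _; rewrite scale0r.
  rewrite (bigD1 (msup m)) ?mD ?eqxx //= big1 ?addr0 // => s /andP[/andP[_ /eqP->]].
  by rewrite eqxx.
apply: eq_bigr => s _; rewrite mulr_suml; apply: eq_bigr => m /eqP ms.
rewrite prod_vars -scalerAl -mpolyXD submK //; apply/mnm_lepP => v; rewrite mnmE -ms inE.
by case: (m v).
Qed.

Lemma cohomology_pi_eq0 f : cohomology_pi (n:=n) D f = 0 <-> in_ideal a D f.
Proof.
have E1 : cohomology_pi (n:=n) D f = 0 <-> SR_pi D f \in @theta_ideal k n N D.
  exact: ideal_pi_eq0.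
have E2 : (SR_pi D f \in @theta_ideal k n N D) <->
    exists q : 'I_n -> {mpoly K[N]}, f - \sum_i q i * thetap a i \in SR_ideal (k:=k) (n:=n) D.
  have := @ideal_pi_span _ (SR_ideal (k:=k) (n:=n) D) n (thetap a) f.
  move=> <-; split=> [/ideal_genP//|h]; exact/ideal_genP.
split=> [/E1/E2[q /SR_idealP h]|[q h]]; first by exists q.
by apply/E1/E2; exists q; apply/SR_idealP.
Qed.

End Presentation.

Section CoefficientField.
Variables (k : fieldType) (char2 : 2%N \in [pchar k]) (n N : nat).
Local Notation K := (coef_field k n N).

Definition coef_const : {rmorphism k -> K} :=
  (@tofrac {mpoly k[n * N]} : {rmorphism _ -> _}) \o @mpolyC (n * N) k.

Lemma coef_field_char2 : 2%N \in [pchar K].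
Proof. exact: (rmorph_pchar coef_const char2). Qed.

Definition coef_der (i : 'I_n) (v : 'I_N) : K -> K := frac_der (@mderiv (n * N) k (mxvec_index i v)).

Lemma coef_derD i v : {morph coef_der i v : x y / x + y}.
Proof. by apply: frac_derD => *; [exact: mderivD | exact: mderivM]. Qed.

Lemma coef_derM i v x y : coef_der i v (x * y) = coef_der i v x * y + x * coef_der i v y.
Proof. by apply: frac_derM => *; exact: mderivM. Qed.

Lemma coef_der_coef i v i' v' :
  coef_der i v (coef k i' v') = ((i == i') && (v == v'))%:R.
Proof.
rewrite /coef_der /coef frac_der_tofrac; last by move=> *; exact: mderivM.
rewrite mderivX mnm1E.
have -> : (mxvec_index i' v' == mxvec_index i v) = (i == i') && (v == v').
  rewrite /mxvec_index (inj_eq (@cast_ord_inj _ _ _)) (inj_eq enum_rank_inj).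
  by rewrite xpair_eqE eq_sym [v' == v]eq_sym.
case: andP => [[/eqP-> /eqP->]|_]; last by rewrite scale0r tofrac0.
rewrite scale1r -tofrac1 -mpolyX0; congr (tofrac 'X_[_]).
by apply/mnmP => w; rewrite mnmBE subnn mnmE.
Qed.

End CoefficientField.

Theorem theorem1p2 (k : fieldType) (char2 : 2%N \in [pchar k])
    (n N : nat) (D : scomplex N) (hD : homology_sphere k n D)
    (m : nat) (hm : (m.*2 <= n)%N)
    (g : cohomology k n D) (hg : in_degree m g)
    (hQ : ell k n D ^+ (n - m.*2) * g ^+ 2 = 0) :
  g = 0.
Proof.
case: hg hQ => p hp ->.
have -> : ell k n D ^+ (n - m.*2) * cohomology_pi D p ^+ 2 =
    cohomology_pi D ((\sum_(j < N) 'X_j) ^+ (n - m.*2) * p ^+ 2).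
  by rewrite /cohomology_pi /SR_pi pi_pi_monomial.
move=> /cohomology_pi_eq0 hJ; apply/cohomology_pi_eq0.
have K2 := coef_field_char2 char2 n N.
apply: (anisotropic_power K2 (@coef_derD k n N) (@coef_derM k n N) (@coef_der_coef k n N)
  (@face_sub N D) (face0 D) (proj2 (proj1 hD)) (wall_sum char2 hD K2)
  (sphere_exact char2 hD (@coef_const k n N)) (sphere_top char2 hD (@coef_const k n N))
  hp (s := n - m.*2)); first by rewrite subnK.
by rewrite mulrC.
Qed.
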